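(* Let $b>0$, let $f\in C^2[-b,b]$ be complex-valued with $f(x)\ne0$ on $[-b,b]$ and $f(0)=1$, let $q_f:=f''/f$, $h:=f'(0)$, and let $\mathbf{K}_f$ be the kernel defined in the context. Let $n\ge1$ and $q_f\in C^{(n-1)}[-b,b]$. Then $$\partial_t^n\mathbf{K}_f(0,0)=\frac1{2^{n+1}}\biggl(q_f^{(n-1)}(0)+\sum_{\ell=1}^{[n/2]}(-1)^\ell\sum_{d=0}^{n-2\ell}\bigl(1+(-1)^n\delta(d)\bigr)q_f^{(d-1)}(0)\sum_{\substack{n_1+\ldots+n_\ell=n-d-2\ell,\\0\le n_1\le\ldots\le n_\ell}}S^n_{\ell;d;(n_1,\ldots,n_\ell)}\prod_{i=1}^\ell q_f^{(n_i)}(0)\biggr),$$ where $q_f^{(-1)}(0):=h=f'(0)$, the coefficients $S^n_{\ell;d;(n_1,\ldots,n_\ell)}$ are the numbers defined in the context (they do not depend on $q_f$), and $\delta(d)=1$ if $d=0$, $\delta(d)=0$ otherwise. The formula also holds for $n=0$ for any $q_f\in C[-b,b]$.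
   Context: Let $\mathbf{H}_f(u,v)$ be the unique solution, on $\{(u,v):|u|\le b,|v|\le b,|u+v|\le b\}$, of the Goursat problem $$\frac{\partial^2\mathbf{H}_f}{\partial u\,\partial v}=q_f(u+v)\mathbf{H}_f(u,v),\qquad \mathbf{H}_f(u,0)=\frac{f'(0)}2+\frac12\int_0^uq_f(s)\,ds,\qquad \mathbf{H}_f(0,v)=\frac{f'(0)}2,$$ and $\mathbf{K}_f(x,t)=\mathbf{H}_f\bigl(\frac{x+t}2,\frac{x-t}2\bigr)$ for $(x,t)\in[-b,b]^2$. Numbers $S^n_{\ell;d;(n_1,\ldots,n_\ell)}$: a list $\ell;d;(n_1,\ldots,n_\ell)$ of non-negative integers is admissible for $n$ if $0\le\ell\le n/2$, $0\le d\le n-2\ell$, $0\le n_1\le\ldots\le n_\ell$ and $n_1+\ldots+n_\ell+2\ell+d=n$. $S^n$ is $0$ on non-admissible lists; $S^0_{0;0;()}=\frac12$, $S^n_{0;n;()}=1$ for $n\ge1$; and for lists admissible for $n+1$ ($n\ge 0$), $$S^{n+1}_{\ell;d;(n_1,\ldots,n_\ell)}=\epsilon\,S^n_{\ell;d-1;(n_1,\ldots,n_\ell)}+\sum_{n_k\in\{n_1,\ldots,n_\ell\}}\binom{d+n_k}{n_k}S^n_{\ell-1;d+n_k+1;(n_1,\ldots,n_{k-1},n_{k+1},\ldots,n_\ell)},$$ where $\epsilon=1+(-1)^n$ if $d=1$ and $\epsilon=1$ if $d\ne1$, and the sum runs over the distinct values among $n_1,\ldots,n_\ell$ (each used once). $[n/2]$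 denotes the integer part. *)

(* Defs.v *)
From Stdlib Require Import Reals Lia Lra.
From Coquelicot Require Import Coquelicot.
From Stdlib Require Import Arith Bool List Sorted FinFun.
Import ListNotations.
Local Open Scope bool_scope.
Local Open Scope R_scope.

(* Functions of one real variable are total functions [R -> C]; everything
    below depends only on their values on the set [A].  At an end point of an
    interval the derivative is therefore the one-sided one. *)

Definition Icc (a b : R) : R -> Prop := fun x => a <= x <= b.

(* Coquelicot's [is_derive] with the filter [locally x] restricted to [A]. *)
Definition is_derive_on (A : R -> Prop) (g : R -> C) (x : R) (l : C) : Prop :=
  filterdiff (K := R_AbsRing) (V := C_R_NormedModule) g
    (within A (locally x)) (fun y : R => scal y (l : C_R_NormedModule)).

Definition ex_derive_on (A : R -> Prop) (g : R -> C) (x : R) : Prop :=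
  exists l : C, is_derive_on A g x l.

Definition derive_on (A : R -> Prop) (g : R -> C) (x : R) : C :=
  iota (T := C_R_CompleteNormedModule) (is_derive_on A g x).

Fixpoint derive_n_on (A : R -> Prop) (g : R -> C) (n : nat) : R -> C :=
  match n with
  | O => g
  | S m => derive_on A (derive_n_on A g m)
  end.

Definition ex_derive_n_on (A : R -> Prop) (g : R -> C) (n : nat) : Prop :=
  forall j : nat, (j < n)%nat ->
  forall x : R, A x -> ex_derive_on A (derive_n_on A g j) x.

Definition is_derive_n_on
    (A : R -> Prop) (g : R -> C) (n : nat) (x : R) (l : C) : Prop :=
  ex_derive_n_on A g n /\ derive_n_on A g n x = l.

Definition Ck_on (A : R -> Prop) (k : nat) (g : R -> C) : Prop :=
  ex_derive_n_on A g k /\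
  continuous_on (T := R_UniformSpace) (U := C_UniformSpace)
    A (derive_n_on A g k).

Lemma minus_minus_l (G : AbelianGroup) (z x y : G) :
  minus (minus z x) (minus z y) = minus y x.
Proof.
unfold minus; rewrite (opp_plus z), opp_opp, (plus_comm z), <- plus_assoc.
rewrite (plus_assoc z), plus_opp_r, plus_zero_l; apply plus_comm.
Qed.

Lemma is_derive_on_unique (a b : R) (g : R -> C) (x : R) (l1 l2 : C) :
  a < b -> Icc a b x ->
  is_derive_on (Icc a b) g x l1 -> is_derive_on (Icc a b) g x l2 -> l1 = l2.
Proof.
intros Hab [Hax Hxb] [_ H1] [_ H2].
assert (Hx : is_filter_lim (within (Icc a b) (locally x)) x).
{ intros P HP; unfold within.
  apply (filter_imp P); [now intros y Hy _ | exact HP]. }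
specialize (H1 x Hx); specialize (H2 x Hx).
apply (ball_norm_eq (V := C_R_NormedModule)).
intros eps.
assert (He : 0 < eps / 4) by (destruct eps; simpl; lra).
specialize (H1 (mkposreal _ He)); specialize (H2 (mkposreal _ He)).
destruct (filter_and _ _ H1 H2) as [d Hd]; simpl in Hd.
assert (Hy : exists y, Icc a b y /\ y <> x /\ Rabs (y - x) < d).
{ pose proof (cond_pos d) as Hd0.
  destruct (Rlt_dec x b) as [Hlt | Hge].
  - exists (x + Rmin (d / 2) (b - x)).
    assert (0 < Rmin (d / 2) (b - x)) by (apply Rmin_glb_lt; lra).
    pose proof (Rmin_l (d / 2) (b - x)); pose proof (Rmin_r (d / 2) (b - x)).
    repeat split; try lra.
    rewrite Rabs_pos_eq; lra.
  - exists (x - Rmin (d / 2) (x - a)).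
    assert (0 < Rmin (d / 2) (x - a)) by (apply Rmin_glb_lt; lra).
    pose proof (Rmin_l (d / 2) (x - a)); pose proof (Rmin_r (d / 2) (x - a)).
    repeat split; try lra.
    rewrite Rabs_left; lra. }
destruct Hy as [y [HyI [Hyx Hyd]]].
destruct (Hd y Hyd HyI) as [E1 E2].
set (D := @minus C_R_NormedModule (g y) (g x)).
set (s := minus y x : R).
assert (Hs : 0 < Rabs s) by (apply Rabs_pos_lt; unfold s, minus, plus, opp; simpl; lra).
change (norm (@minus C_R_NormedModule D (scal s (l1 : C_R_NormedModule)))
        <= eps / 4 * Rabs s) in E1.
change (norm (@minus C_R_NormedModule D (scal s (l2 : C_R_NormedModule)))
        <= eps / 4 * Rabs s) in E2.
assert (Hsc : norm (scal s (@minus C_R_NormedModule l2 l1)) <= eps / 2 * Rabs s).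
{ replace (scal s (@minus C_R_NormedModule l2 l1))
    with (@minus C_R_NormedModule (minus D (scal s (l1 : C_R_NormedModule)))
                                  (minus D (scal s (l2 : C_R_NormedModule)))).
  - eapply Rle_trans; [apply norm_triangle|].
    rewrite norm_opp. lra.
  - rewrite (scal_minus_distr_l (V := C_R_NormedModule)).
    apply (minus_minus_l C_R_NormedModule). }
unfold ball_norm.
replace (@minus C_R_NormedModule l2 l1)
  with (scal (/ s) (scal s (@minus C_R_NormedModule l2 l1))).
- eapply Rle_lt_trans; [apply (norm_scal (K := R_AbsRing) (V := C_R_NormedModule))|].
  change (abs (/ s)) with (Rabs (/ s)).
  rewrite Rabs_inv.
  apply Rle_lt_trans with (/ Rabs s * (eps / 2 * Rabs s)).
  + apply Rmult_le_compat_l; [left; now apply Rinv_0_lt_compat | exact Hsc].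
  + replace (/ Rabs s * (eps / 2 * Rabs s)) with (eps / 2) by (field; lra).
    destruct eps; simpl; lra.
- rewrite scal_assoc.
  replace (mult (/ s) s) with (@one R_Ring); [apply scal_one|].
  unfold mult, one; simpl. field.
  unfold s, minus, plus, opp; simpl; lra.
Qed.

Lemma derive_on_correct (a b : R) (g : R -> C) (x : R) (l : C) :
  a < b -> Icc a b x ->
  is_derive_on (Icc a b) g x l -> derive_on (Icc a b) g x = l.
Proof.
intros Hab Hx Hl.
apply (iota_unique (V := C_R_CompleteNormedModule)); [|exact Hl].
intros y Hy; exact (is_derive_on_unique a b g x y l Hab Hx Hy Hl).
Qed.

Definition goursat_domain (b u v : R) : Prop :=
  Rabs u <= b /\ Rabs v <= b /\ Rabs (u + v) <= b.

Definition Dv (b : R) (H : R -> R -> C) (u v : R) : C :=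
  derive_on (fun v' => goursat_domain b u v') (fun v' => H u v') v.

(* Every slice of [goursat_domain b] parallel to an axis and meeting the
   domain is a closed interval of length at least [b], so partial derivatives
   taken along slices are well defined up to the boundary. *)
Record goursat_solution (b : R) (q : R -> C) (h : C) (H : R -> R -> C) : Prop :=
{ goursat_continuous :
    continuous_on (T := prod_UniformSpace R_UniformSpace R_UniformSpace)
      (U := C_UniformSpace)
      (fun p => goursat_domain b (fst p) (snd p)) (fun p => H (fst p) (snd p));
  goursat_ex_Dv :
    forall u v, goursat_domain b u v ->
    ex_derive_on (fun v' => goursat_domain b u v') (fun v' => H u v') v;
  goursat_equation :
    forall u v, goursat_domain b u v ->
    is_derive_on (fun u' => goursat_domain b u' v) (fun u' => Dv b H u' v) u
      (Cmult (q (u + v)) (H u v));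
  goursat_boundary_u :
    forall u, Rabs u <= b ->
    H u 0 = Cplus (Cdiv h (RtoC 2))
                  (Cmult (RtoC (/ 2)) (RInt (V := C_R_CompleteNormedModule) q 0 u));
  goursat_boundary_v :
    forall v, Rabs v <= b -> H 0 v = Cdiv h (RtoC 2) }.

Definition kernel (H : R -> R -> C) (x t : R) : C :=
  H ((x + t) / 2) ((x - t) / 2).

Definition potential (b : R) (f : R -> C) (x : R) : C :=
  Cdiv (derive_n_on (Icc (- b) b) f 2 x) (f x).

Definition slope0 (b : R) (f : R -> C) : C := derive_on (Icc (- b) b) f 0.

(* Shifted index: [qjet b f (S k)] is the [k]-th derivative of the potential
   at 0, and [qjet b f 0] is the "derivative of order -1", i.e. [f'(0)]. *)
Definition qjet (b : R) (f : R -> C) (i : nat) : C :=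
  match i with
  | O => slope0 b f
  | S k => derive_n_on (Icc (- b) b) (potential b f) k 0
  end.

Fixpoint nondecreasing (ns : list nat) : bool :=
  match ns with
  | x :: (y :: _) as ns' => (x <=? y)%nat && nondecreasing ns'
  | _ => true
  end.

Definition admissible (n l d : nat) (ns : list nat) : bool :=
  (2 * l <=? n)%nat && (d <=? n - 2 * l)%nat && (length ns =? l)%nat &&
  nondecreasing ns && (list_sum ns + 2 * l + d =? n)%nat.

Fixpoint remove_first (k : nat) (ns : list nat) : list nat :=
  match ns with
  | [] => []
  | x :: ns' => if (x =? k)%nat then ns' else x :: remove_first k ns'
  end.

Definition Rlist_sum (rs : list R) : R := fold_right Rplus 0 rs.

(* In the recursion the index [d - 1] with [d = 0] is not admissible, whence
   the value 0 in that case; [nodup] keeps one copy of each value. *)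
Fixpoint Scoef (n l d : nat) (ns : list nat) : R :=
  if admissible n l d ns then
    match n with
    | O => / 2
    | S m =>
        (if (d =? 1)%nat then 1 + (-1) ^ m else 1) *
          match d with
          | O => 0
          | S d' => Scoef m l d' ns
          end
        + Rlist_sum
            (map (fun k => Binomial.C (d + k) k *
                           Scoef m (l - 1) (d + k + 1) (remove_first k ns))
                 (nodup Nat.eq_dec ns))
    end
  else 0.

Lemma admissible_l0 (n : nat) : admissible n 0 n [] = true.
Proof.
unfold admissible; simpl.
rewrite Nat.sub_0_r, Nat.leb_refl, Nat.eqb_refl; reflexivity.
Qed.

Lemma Scoef_l0 (n : nat) : (1 <= n)%nat -> Scoef n 0 n [] = 1.
Proof.
induction n as [|[|n] IH]; intros Hn; [lia| |].
- simpl; unfold Rlist_sum; simpl; lra.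
- change (Scoef (S (S n)) 0 (S (S n)) []) with
    (if admissible (S (S n)) 0 (S (S n)) [] then
       1 * Scoef (S n) 0 (S n) [] + 0 else 0).
  rewrite admissible_l0, IH; [lra | lia].
Qed.

Fixpoint bounded_lists (l m : nat) : list (list nat) :=
  match l with
  | O => [[]]
  | S l' => flat_map (fun k => map (cons k) (bounded_lists l' m)) (seq 0 (S m))
  end.

Definition sum_lists (l m : nat) : list (list nat) :=
  filter (fun ns => (nondecreasing ns && (list_sum ns =? m)%nat)%bool)
         (bounded_lists l m).

Lemma in_bounded_lists (l m : nat) (ns : list nat) :
  In ns (bounded_lists l m) <->
  length ns = l /\ Forall (fun k => (k <= m)%nat) ns.
Proof.
revert ns; induction l as [|l IH]; intros ns; cbn [bounded_lists].
- split.
  + intros [<- | []]; now split.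
  + intros [Hl _]; destruct ns; [now left | discriminate].
- rewrite in_flat_map; split.
  + intros [k [Hk Hns]].
    apply in_map_iff in Hns; destruct Hns as [ns' [<- Hns']].
    apply IH in Hns'; destruct Hns' as [Hl Hf].
    apply in_seq in Hk; simpl; split; [now rewrite Hl |].
    constructor; [lia | exact Hf].
  + intros [Hl Hf]; destruct ns as [|k ns]; [discriminate|].
    inversion Hf; subst; injection Hl as Hl.
    exists k; split; [apply in_seq; lia|].
    apply in_map, IH; now split.
Qed.

Lemma nondecreasingP (ns : list nat) :
  nondecreasing ns = true <-> Sorted le ns.
Proof.
induction ns as [|x ns IH]; [now split; constructor|].
destruct ns as [|y ns].
- split; [repeat constructor | reflexivity].
- change (nondecreasing (x :: y :: ns))
    with ((x <=? y)%nat && nondecreasing (y :: ns))%bool.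
  rewrite Bool.andb_true_iff, IH, Nat.leb_le; split.
  + intros [Hxy Hs]; constructor; [exact Hs | now constructor].
  + intros Hs; inversion Hs as [|? ? Hs' Hh]; subst.
    inversion Hh; now split.
Qed.

Lemma list_sum_ge (ns : list nat) :
  Forall (fun k => (k <= list_sum ns)%nat) ns.
Proof.
induction ns as [|x ns IH]; constructor; simpl; [lia|].
eapply Forall_impl; [|exact IH]; simpl; lia.
Qed.

Lemma in_sum_lists (l m : nat) (ns : list nat) :
  In ns (sum_lists l m) <->
  length ns = l /\ Sorted le ns /\ list_sum ns = m.
Proof.
unfold sum_lists.
rewrite filter_In, in_bounded_lists, Bool.andb_true_iff, nondecreasingP,
  Nat.eqb_eq.
split; [tauto|].
intros [Hl [Hs <-]]; repeat split; trivial; apply list_sum_ge.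
Qed.

Lemma NoDup_bounded_lists (l m : nat) : NoDup (bounded_lists l m).
Proof.
induction l as [|l IH]; [repeat constructor; tauto|].
cbn [bounded_lists].
generalize (seq_NoDup (S m) 0); generalize (seq 0 (S m)) as ks.
induction ks as [|k ks IHk]; intros Hk; simpl; [constructor|].
inversion Hk as [|? ? Hnk Hks]; subst.
apply NoDup_app; [|exact (IHk Hks)|].
- apply Injective_map_NoDup; [|exact IH].
  intros x y E; now injection E.
- intros ns H1 H2.
  apply in_map_iff in H1; destruct H1 as [s1 [<- _]].
  apply in_flat_map in H2; destruct H2 as [k' [Hk' H2]].
  apply in_map_iff in H2; destruct H2 as [s2 [E _]].
  injection E as -> _; contradiction.
Qed.

Lemma NoDup_sum_lists (l m : nat) : NoDup (sum_lists l m).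
Proof. apply NoDup_filter, NoDup_bounded_lists. Qed.

Definition Clist_sum (zs : list C) : C := fold_right Cplus (RtoC 0) zs.
Definition Clist_prod (zs : list C) : C := fold_right Cmult (RtoC 1) zs.

Definition delta (d : nat) : R := if (d =? 0)%nat then 1 else 0.

(* Main.v *)
Require Import Defs.
From Stdlib Require Import Reals.
From Coquelicot Require Import Coquelicot.
From Stdlib Require Import List.
From Stdlib Require Import Lra Lia Permutation Sorted Arith.
Import ListNotations.
Open Scope R_scope.

(** Write [q] for the potential. Since [K(0,t) = H(t/2,-t/2)], each derivative
    in [t] is half of [d_u - d_v] applied to [H] and restricted to the
    antidiagonal [u + v = 0]. Two facts make this operator easy to iterate.
    First, [d_u - d_v] kills every function of [u + v], so the factors
    [q^(k)(u+v)] that appear behave as constants and are only ever evaluated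
    at 0. Secondly, [H_uv = q H] eliminates mixed derivatives: for [d >= 1],

      (d_u - d_v) d_u^d H = d_u^(d+1) H
                            - sum_k C(d-1,k) q^(k)(u+v) d_u^(d-1-k) H,

    and the same with [u] and [v] exchanged, up to the sign. Hence
    [(d_u - d_v)^m H] is a combination of the terms [d_u^d H + (-1)^m d_v^d H].
    Grouping its coefficients by the multiset of the orders [k] of the factors
    [q^(k)] gives exactly the recursion that defines the numbers [S]: the term
    with [eps] is the first summand above, and the sum over distinct values is
    the choice of the factor that the last differentiation produced. At the
    origin the Goursat data give [H = h/2], [d_u^d H = q^(d-1)(0)/2] and
    [d_v^d H = 0] for [d >= 1], which is the formula.

    The analytic part is that these derivatives exist and may be taken in any
    order. The Goursat problem is turned into two integral equations

      H_u(u,v) = q(u)/2 + int_0^v q(u+r) H(u,r) dr,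
      H_v(u,v) = int_0^u q(s+v) H(s,v) ds

    ([H_der_u], [H_der_v]), which have the same shape after exchanging the
    variables. Differentiating such an equation under the integral sign
    expresses each further derivative through lower ones ([jet_induction]), as
    long as [q] has the derivatives required; this gives one derivative of [H]
    more than [q] has. All of it takes place in the open hexagon, which
    contains the whole antidiagonal [|t| <= b], so no one-sided derivative of
    [H] or of [q] is ever met. The combinatorial part is
    [csum_remove_first], [order_coef_succ] and [order_coef_derivative]; the
    two meet in [line_sum_der]. *)

(** * The open hexagon *)

Definition hexagon (b u v : R) : Prop :=
  Rabs u < b /\ Rabs v < b /\ Rabs (u + v) < b.

Lemma hexagon_sym (b u v : R) : hexagon b u v -> hexagon b v u.
Proof. unfold hexagon; rewrite (Rplus_comm v u); tauto. Qed.

Lemma hexagon_open (b u v : R) :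
  hexagon b u v -> locally_2d (hexagon b) u v.
Proof.
intros [Hu [Hv Hs]].
assert (Hd : 0 < Rmin (b - Rabs u) (Rmin (b - Rabs v) ((b - Rabs (u + v)) / 2)))
  by (repeat apply Rmin_glb_lt; lra).
exists (mkposreal _ Hd); simpl; intros u' v' Hu' Hv'.
pose proof (Rmin_l (b - Rabs u) (Rmin (b - Rabs v) ((b - Rabs (u + v)) / 2))).
pose proof (Rmin_r (b - Rabs u) (Rmin (b - Rabs v) ((b - Rabs (u + v)) / 2))).
pose proof (Rmin_l (b - Rabs v) ((b - Rabs (u + v)) / 2)).
pose proof (Rmin_r (b - Rabs v) ((b - Rabs (u + v)) / 2)).
assert (T : forall a c : R, Rabs a <= Rabs c + Rabs (a - c)).
{ intros a c; replace a with (c + (a - c)) at 1 by ring; apply Rabs_triang. }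
pose proof (T u' u); pose proof (T v' v); pose proof (T (u' + v') (u + v)).
replace (u' + v' - (u + v)) with ((u' - u) + (v' - v)) in * by ring.
pose proof (Rabs_triang (u' - u) (v' - v)).
unfold hexagon; repeat split; lra.
Qed.

(** The paths of integration, from an axis to the point, stay in the hexagon:
    [u + r] lies between [u] and [u + v]. *)
Lemma hexagon_segment (b u v r : R) :
  hexagon b u v -> Rmin 0 v <= r <= Rmax 0 v -> hexagon b u r.
Proof.
unfold hexagon, Rmin, Rmax.
intros [Hu [Hv Hs]] Hr.
apply Rabs_def2 in Hu; apply Rabs_def2 in Hv; apply Rabs_def2 in Hs.
destruct (Rle_dec 0 v); repeat split; apply Rabs_def1; lra.
Qed.

(** * Real integrals with a parameter *)

Lemma locally_section_l (P : R -> R -> Prop) (u v : R) :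
  locally_2d P u v -> locally u (fun x => P x v).
Proof.
intros [d Hd]; exists d; intros x Hx; apply Hd; [exact Hx|].
rewrite Rminus_diag, Rabs_R0; apply cond_pos.
Qed.

Lemma continuity_2d_section_r (g : R -> R -> R) (u v : R) :
  continuity_2d_pt g u v -> continuous (g u) v.
Proof.
intros H; apply continuity_pt_filterlim.
intros eps He; destruct (H (mkposreal _ He)) as [d Hd].
exists d; split; [apply cond_pos|].
intros y [_ Hy]; apply Hd; [|exact Hy].
rewrite Rminus_diag, Rabs_R0; apply cond_pos.
Qed.

Lemma abs_RInt_le_const_gen (g : R -> R) (a c M : R) :
  ex_RInt g a c ->
  (forall t, Rmin a c <= t <= Rmax a c -> Rabs (g t) <= M) ->
  Rabs (RInt g a c) <= Rabs (c - a) * M.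
Proof.
intros Hex HM; destruct (Rle_dec a c) as [Hac | Hac].
- rewrite (Rabs_pos_eq (c - a)) by lra.
  apply abs_RInt_le_const; trivial.
  now rewrite Rmin_left, Rmax_right in HM by lra.
- rewrite <- (opp_RInt_swap g c a) by now apply ex_RInt_swap.
  change (opp ?x) with (- x); rewrite Rabs_Ropp.
  rewrite (Rabs_left (c - a)), Ropp_minus_distr by lra.
  apply abs_RInt_le_const; [lra | now apply ex_RInt_swap |].
  now rewrite Rmin_right, Rmax_left in HM by lra.
Qed.

Section ParametricIntegral.
Variables (b : R) (g : R -> R -> R).
Hypothesis g_cont : forall u v, hexagon b u v -> continuity_2d_pt g u v.

Lemma ex_RInt_section (u v : R) : hexagon b u v -> ex_RInt (g u) 0 v.
Proof.
intros H; apply (ex_RInt_continuous (V := R_CompleteNormedModule)).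
intros r Hr; apply continuity_2d_section_r, g_cont.
now apply hexagon_segment with v.
Qed.

Lemma is_derive_RInt_section (u v : R) :
  hexagon b u v -> is_derive (fun v => RInt (g u) 0 v) v (g u v).
Proof.
intros H; apply (is_derive_RInt (V := R_NormedModule)) with (a := 0).
- pose proof (locally_2d_1d_const_x _ _ _ (hexagon_open b u v H)) as HL.
  revert HL; apply filter_imp; intros v' Hv'.
  apply (RInt_correct (V := R_CompleteNormedModule)); now apply ex_RInt_section.
- now apply continuity_2d_section_r, g_cont.
Qed.

(** Moving [(u,v)] changes the integral over the fixed segment by little, by
    uniform continuity on that segment, and changes the end point by little
    where [g] is bounded. *)
Lemma continuity_2d_RInt_section (u v : R) :
  hexagon b u v -> continuity_2d_pt (fun u v => RInt (g u) 0 v) u v.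
Proof.
intros H eps.
assert (Hv1 : 0 < 2 * (Rabs v + 1)) by (pose proof (Rabs_pos v); lra).
assert (He1 : 0 < eps / (2 * (Rabs v + 1)))
  by (apply Rdiv_lt_0_compat; [apply cond_pos | exact Hv1]).
assert (HM0 : 0 < 2 * (Rabs (g u v) + 1)) by (pose proof (Rabs_pos (g u v)); lra).
assert (He2 : 0 < eps / (2 * (Rabs (g u v) + 1)))
  by (apply Rdiv_lt_0_compat; [apply cond_pos | exact HM0]).
(* Uniformity in [r] along the fixed segment from 0 to [v]. *)
destruct (uniform_continuity_2d_1d' g (Rmin 0 v) (Rmax 0 v) u
            (fun r Hr => g_cont u r (hexagon_segment b u v r H Hr))
            (mkposreal _ He1)) as [d1 Hd1].
(* A local bound of [g] controls the piece from [v] to the moved end point. *)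
destruct (g_cont u v H (mkposreal _ Rlt_0_1)) as [d2 Hd2]; simpl in Hd2.
destruct (hexagon_open b u v H) as [d3 Hd3].
assert (Hd : 0 < Rmin (Rmin d1 d2) (Rmin d3 (eps / (2 * (Rabs (g u v) + 1)))))
  by (repeat apply Rmin_glb_lt; trivial; apply cond_pos).
exists (mkposreal _ Hd); simpl; intros u' v' Hu' Hv'.
pose proof (Rmin_l (Rmin d1 d2) (Rmin d3 (eps / (2 * (Rabs (g u v) + 1))))).
pose proof (Rmin_r (Rmin d1 d2) (Rmin d3 (eps / (2 * (Rabs (g u v) + 1))))).
pose proof (Rmin_l d1 d2); pose proof (Rmin_r d1 d2).
pose proof (Rmin_l d3 (eps / (2 * (Rabs (g u v) + 1)))).
pose proof (Rmin_r d3 (eps / (2 * (Rabs (g u v) + 1)))).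
assert (Hu'v : hexagon b u' v).
{ apply Hd3; [lra|]. rewrite Rminus_diag, Rabs_R0; apply cond_pos. }
assert (Hu'v' : hexagon b u' v') by (apply Hd3; lra).
pose proof (ex_RInt_section _ _ Hu'v) as E1.
pose proof (ex_RInt_section _ _ Hu'v') as E2.
pose proof (ex_RInt_section _ _ H) as E3.
assert (E4 : ex_RInt (g u') v v')
  by (apply (ex_RInt_Chasles (V := R_NormedModule)) with 0;
      [now apply ex_RInt_swap | exact E2]).
assert (Split : RInt (g u') 0 v' - RInt (g u) 0 v =
                RInt (g u') v v' + RInt (fun r => g u' r - g u r) 0 v).
{ rewrite <- (RInt_Chasles (g u') 0 v v' E1 E4).
  assert (Em : RInt (fun r => g u' r - g u r) 0 v =
               RInt (g u') 0 v - RInt (g u) 0 v)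
    by exact (RInt_minus (g u') (g u) 0 v E1 E3).
  rewrite Em; unfold plus; simpl; ring. }
rewrite Split.
assert (B1 : Rabs (RInt (g u') v v') <= Rabs (v' - v) * (Rabs (g u v) + 1)).
{ apply abs_RInt_le_const_gen; trivial; intros r Hr.
  assert (Hrv : Rabs (r - v) <= Rabs (v' - v)).
  { revert Hr; unfold Rmin, Rmax; destruct (Rle_dec v v'); intros Hr.
    - rewrite 2!Rabs_pos_eq; lra.
    - rewrite 2!Rabs_left1; lra. }
  assert (HB : Rabs (g u' r - g u v) < 1) by (apply Hd2; lra).
  pose proof (Rabs_triang (g u v) (g u' r - g u v)) as HT.
  replace (g u v + (g u' r - g u v)) with (g u' r) in HT by ring; lra. }
assert (B2 : Rabs (RInt (fun r => g u' r - g u r) 0 v)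
             <= Rabs (v - 0) * (eps / (2 * (Rabs v + 1)))).
{ apply abs_RInt_le_const_gen; [now apply (ex_RInt_minus (V := R_NormedModule))|].
  intros r Hr; left; apply (Hd1 r u r u'); trivial.
  - pose proof (cond_pos d1); lra.
  - assert (HA : Rabs (u' - u) < d1) by lra.
    apply Rabs_def2 in HA; lra.
  - rewrite Rminus_diag, Rabs_R0; apply cond_pos. }
rewrite Rminus_0_r in B2.
eapply Rle_lt_trans; [apply Rabs_triang|].
assert (B3 : Rabs (v' - v) * (Rabs (g u v) + 1) < eps / 2).
{ apply Rlt_le_trans with (eps / (2 * (Rabs (g u v) + 1)) * (Rabs (g u v) + 1)).
  - apply Rmult_lt_compat_r; lra.
  - right; field; lra. }
assert (B4 : Rabs v * (eps / (2 * (Rabs v + 1))) <= eps / 2).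
{ apply Rle_trans with ((Rabs v + 1) * (eps / (2 * (Rabs v + 1)))).
  - apply Rmult_le_compat_r; lra.
  - right; field; lra. }
lra.
Qed.

Variable gu : R -> R -> R.
Hypothesis gu_cont : forall u v, hexagon b u v -> continuity_2d_pt gu u v.
Hypothesis g_der :
  forall u v, hexagon b u v -> is_derive (fun z => g z v) u (gu u v).

Lemma is_derive_RInt_param_section (u v : R) :
  hexagon b u v ->
  is_derive (fun z => RInt (g z) 0 v) u (RInt (gu u) 0 v).
Proof.
intros H.
pose proof (locally_section_l _ _ _ (hexagon_open b u v H)) as HL.
rewrite (RInt_ext (gu u) (fun t => Derive (fun z => g z t) u)).
2:{ intros r Hr; symmetry; apply is_derive_unique, g_der.
    apply hexagon_segment with v; trivial; lra. }
apply is_derive_RInt_param.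
- revert HL; apply filter_imp; intros u' Hu' r Hr.
  exists (gu u' r); apply g_der; now apply hexagon_segment with v.
- intros r Hr; pose proof (hexagon_segment b u v r H Hr) as Hur.
  apply continuity_2d_pt_ext_loc with gu; [|now apply gu_cont].
  pose proof (hexagon_open b u r Hur) as [d Hd]; exists d.
  intros u' r' Hu' Hr'; symmetry; apply is_derive_unique, g_der; now apply Hd.
- revert HL; apply filter_imp; intros u' Hu'; now apply ex_RInt_section.
Qed.

End ParametricIntegral.

Lemma is_derive_along_curve (g gu : R -> R -> R) (x y : R -> R) (t gv dx dy : R) :
  locally_2d (fun u v => is_derive (fun z => g z v) u (gu u v)) (x t) (y t) ->
  continuity_2d_pt gu (x t) (y t) ->
  is_derive (fun z => g (x t) z) (y t) gv ->
  is_derive x t dx -> is_derive y t dy ->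
  is_derive (fun s => g (x s) (y s)) t (gu (x t) (y t) * dx + gv * dy).
Proof.
intros Hu Hc Hv Hx Hy.
assert (D : filterdiff (fun p : R * R => g (fst p) (snd p)) (locally (x t, y t))
              (fun p : R * R =>
                 plus (scal (fst p) (gu (x t) (y t))) (scal (snd p) gv))).
{ apply is_derive_filterdiff; [now apply locally_2d_locally in Hu | exact Hv |].
  now apply continuity_2d_pt_filterlim. }
apply is_derive_Reals, derivable_pt_lim_comp_2d; [|now apply is_derive_Reals..].
now apply filterdiff_differentiable_pt_lim.
Qed.

(** * Finite sums of complex numbers over a list *)

Definition csum {A : Type} (l : list A) (F : A -> C) : C := Clist_sum (map F l).

Section FiniteSums.
Context {A B : Type}.
Implicit Types (F G : A -> C) (l : list A).

Lemma csum_cons (x : A) l F : csum (x :: l) F = Cplus (F x) (csum l F).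
Proof. reflexivity. Qed.

Lemma csum_app l l' F : csum (l ++ l') F = Cplus (csum l F) (csum l' F).
Proof.
induction l as [|x l IH]; simpl app; [unfold csum; simpl; ring|].
rewrite !csum_cons, IH; ring.
Qed.

Lemma csum_ext l F G : (forall x, In x l -> F x = G x) -> csum l F = csum l G.
Proof. intros H; unfold csum; f_equal; now apply map_ext_in. Qed.

Lemma csum_plus l F G :
  csum l (fun x => Cplus (F x) (G x)) = Cplus (csum l F) (csum l G).
Proof.
induction l as [|x l IH]; [unfold csum; simpl; ring|].
rewrite !csum_cons, IH; ring.
Qed.

Lemma csum_mult_l (c : C) l F : csum l (fun x => Cmult c (F x)) = Cmult c (csum l F).
Proof.
induction l as [|x l IH]; [unfold csum; simpl; ring|].
rewrite !csum_cons, IH; ring.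
Qed.

Lemma csum_0 l F : (forall x, In x l -> F x = RtoC 0) -> csum l F = RtoC 0.
Proof.
induction l as [|x l IH]; intros H; [reflexivity|].
rewrite csum_cons, (H x), IH; [ring | | now left].
intros y Hy; apply H; now right.
Qed.

Lemma csum_map (h : B -> A) (l : list B) F :
  csum (map h l) F = csum l (fun x => F (h x)).
Proof. unfold csum; now rewrite map_map. Qed.

Lemma csum_flat_map (h : B -> list A) (l : list B) F :
  csum (flat_map h l) F = csum l (fun x => csum (h x) F).
Proof.
induction l as [|x l IH]; [reflexivity|].
simpl flat_map; now rewrite csum_app, IH.
Qed.

Lemma csum_perm l l' F : Permutation l l' -> csum l F = csum l' F.
Proof.
induction 1 as [| x l l' _ IH | x y l | l l' l'' _ IH1 _ IH2]; trivial.
- now rewrite !csum_cons, IH.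
- rewrite !csum_cons; ring.
- now rewrite IH1.
Qed.

End FiniteSums.

Lemma csum_switch {A B : Type} (l : list A) (m : list B) (F : A -> B -> C) :
  csum l (fun x => csum m (F x)) = csum m (fun y => csum l (fun x => F x y)).
Proof.
induction l as [|x l IH].
- symmetry; now apply csum_0.
- rewrite csum_cons, IH, <- csum_plus; reflexivity.
Qed.

Lemma csum_seq_first (n : nat) (F : nat -> C) :
  csum (seq 0 (S n)) F = Cplus (F 0%nat) (csum (seq 0 n) (fun i => F (S i))).
Proof. now rewrite <- cons_seq, csum_cons, <- seq_shift, csum_map. Qed.

Lemma csum_seq_last (n : nat) (F : nat -> C) :
  csum (seq 0 (S n)) F = Cplus (csum (seq 0 n) F) (F n).
Proof. rewrite seq_S, csum_app; unfold csum at 2; simpl; ring. Qed.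

(** Pascal's rule in the form used by the Leibniz formula: with
    [a k j = f^(k) g^(j)], the left-hand side is the derivative of the [d]-th
    derivative of [f g]. *)
Lemma leibniz_sum (a : nat -> nat -> C) (d : nat) :
  csum (seq 0 (S d)) (fun k =>
    Cmult (RtoC (Binomial.C d k)) (Cplus (a (S k) (d - k)%nat) (a k (S (d - k))))) =
  csum (seq 0 (S (S d))) (fun k =>
    Cmult (RtoC (Binomial.C (S d) k)) (a k (S d - k)%nat)).
Proof.
transitivity (Cplus
  (csum (seq 0 (S d)) (fun k => Cmult (RtoC (Binomial.C d k)) (a (S k) (d - k)%nat)))
  (csum (seq 0 (S d)) (fun k => Cmult (RtoC (Binomial.C d k)) (a k (S (d - k)))))).
{ rewrite <- csum_plus; apply csum_ext; intros; ring. }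
rewrite (csum_seq_last d), (csum_seq_first d).
rewrite (csum_seq_first (S d)), (csum_seq_last d).
rewrite !C_n_n, !C_n_0, !Nat.sub_diag, !Nat.sub_0_r.
transitivity (Cplus (Cplus (a 0%nat (S d)) (a (S d) 0%nat))
  (csum (seq 0 d) (fun i =>
     Cplus (Cmult (RtoC (Binomial.C d i)) (a (S i) (d - i)%nat))
           (Cmult (RtoC (Binomial.C d (S i))) (a (S i) (S (d - S i))))))).
{ rewrite csum_plus; ring. }
rewrite (csum_ext (seq 0 d) _ (fun i =>
  Cmult (RtoC (Binomial.C (S d) (S i))) (a (S i) (S d - S i)%nat))); [ring|].
intros i Hi; apply in_seq in Hi.
rewrite <- Binomial.pascal, RtoC_plus by lia.
replace (S (d - S i)) with (d - i)%nat by lia.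
replace (S d - S i)%nat with (d - i)%nat by lia; ring.
Qed.

(** * Calculus of complex-valued functions, coordinate by coordinate *)

(** Coordinates, because differentiation under the integral sign and along a
    curve rests on the mean value theorem, which is a statement about
    real-valued functions. *)
Definition cderiv (F : R -> C) (x : R) (l : C) : Prop :=
  is_derive (fun y => fst (F y)) x (fst l) /\
  is_derive (fun y => snd (F y)) x (snd l).

Definition ccont (F : R -> C) (x : R) : Prop :=
  continuity_pt (fun y => fst (F y)) x /\ continuity_pt (fun y => snd (F y)) x.

Definition ccont2 (F : R -> R -> C) (u v : R) : Prop :=
  continuity_2d_pt (fun x y => fst (F x y)) u v /\
  continuity_2d_pt (fun x y => snd (F x y)) u v.

Definition cint (F : R -> C) (a c : R) : C :=
  (RInt (fun y => fst (F y)) a c, RInt (fun y => snd (F y)) a c).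

Definition cDerive (F : R -> C) (x : R) : C :=
  (Derive (fun y => fst (F y)) x, Derive (fun y => snd (F y)) x).

Lemma cDerive_unique (F : R -> C) (x : R) (l : C) :
  cderiv F x l -> cDerive F x = l.
Proof.
intros [H1 H2]; rewrite (surjective_pairing l); unfold cDerive.
f_equal; now apply is_derive_unique.
Qed.

Lemma cderiv_ext_loc (F G : R -> C) (x : R) (l : C) :
  locally x (fun y => F y = G y) -> cderiv F x l -> cderiv G x l.
Proof.
intros HL [H1 H2]; split; eapply is_derive_ext_loc; try eassumption;
  revert HL; apply filter_imp; now intros y ->.
Qed.

Lemma cderiv_const (c : C) (x : R) : cderiv (fun _ => c) x (RtoC 0).
Proof. split; apply (is_derive_const (V := R_NormedModule)). Qed.

Lemma cderiv_plus (F G : R -> C) (x : R) (l m : C) :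
  cderiv F x l -> cderiv G x m ->
  cderiv (fun y => Cplus (F y) (G y)) x (Cplus l m).
Proof.
intros [H1 H2] [H3 H4]; split;
  [exact (is_derive_plus _ _ _ _ _ H1 H3) | exact (is_derive_plus _ _ _ _ _ H2 H4)].
Qed.

Lemma cderiv_mult (F G : R -> C) (x : R) (l m : C) :
  cderiv F x l -> cderiv G x m ->
  cderiv (fun y => Cmult (F y) (G y)) x (Cplus (Cmult l (G x)) (Cmult (F x) m)).
Proof.
intros [H1 H2] [H3 H4].
pose proof (fun n k : R_AbsRing => Rmult_comm n k) as Hcomm.
pose proof (is_derive_mult _ _ _ _ _ H1 H3 Hcomm) as M13.
pose proof (is_derive_mult _ _ _ _ _ H2 H4 Hcomm) as M24.
pose proof (is_derive_mult _ _ _ _ _ H1 H4 Hcomm) as M14.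
pose proof (is_derive_mult _ _ _ _ _ H2 H3 Hcomm) as M23.
split; simpl.
- evar_last; [exact (is_derive_minus _ _ _ _ _ M13 M24)|].
  unfold plus, minus, plus, opp, mult; simpl; ring.
- evar_last; [exact (is_derive_plus _ _ _ _ _ M14 M23)|].
  unfold plus, mult; simpl; ring.
Qed.

Lemma cderiv_eq (F : R -> C) (x : R) (l m : C) :
  cderiv F x l -> l = m -> cderiv F x m.
Proof. now intros H <-. Qed.

Lemma cderiv_mult_l (c : C) (F : R -> C) (x : R) (l : C) :
  cderiv F x l -> cderiv (fun y => Cmult c (F y)) x (Cmult c l).
Proof.
intros H; eapply cderiv_eq.
- apply (cderiv_mult (fun _ => c)); [apply cderiv_const | exact H].
- ring.
Qed.

Lemma cderiv_csum {A : Type} (l : list A) (F : A -> R -> C) (x : R) (F' : A -> C) :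
  (forall i, In i l -> cderiv (F i) x (F' i)) ->
  cderiv (fun y => csum l (fun i => F i y)) x (csum l F').
Proof.
induction l as [|i l IH]; intros H; [apply (cderiv_const (RtoC 0))|].
apply (cderiv_plus (F i)); [apply H; now left|].
apply IH; intros j Hj; apply H; now right.
Qed.

Lemma cderiv_shift (F : R -> C) (u v : R) (l : C) :
  cderiv F (u + v) l -> cderiv (fun z => F (z + v)) u l.
Proof.
intros [H1 H2].
assert (Hs : is_derive (fun z => z + v) u 1) by (auto_derive; [trivial | ring]).
split.
- evar_last; [exact (is_derive_comp (fun y => fst (F y)) _ u _ _ H1 Hs)|].
  apply (scal_one (V := R_NormedModule)).
- evar_last; [exact (is_derive_comp (fun y => snd (F y)) _ u _ _ H2 Hs)|].
  apply (scal_one (V := R_NormedModule)).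
Qed.

Lemma cderiv_ccont (F : R -> C) (x : R) (l : C) : cderiv F x l -> ccont F x.
Proof.
intros [H1 H2]; split; apply continuity_pt_filterlim;
  apply (ex_derive_continuous (V := R_NormedModule)); eexists; eassumption.
Qed.

Lemma ccont2_ext_loc (F G : R -> R -> C) (u v : R) :
  locally_2d (fun x y => F x y = G x y) u v -> ccont2 F u v -> ccont2 G u v.
Proof.
intros [d Hd] [H1 H2]; split.
- apply continuity_2d_pt_ext_loc with (2 := H1).
  exists d; intros x y Hx Hy; now rewrite (Hd x y Hx Hy).
- apply continuity_2d_pt_ext_loc with (2 := H2).
  exists d; intros x y Hx Hy; now rewrite (Hd x y Hx Hy).
Qed.

Lemma ccont2_const (c : C) (u v : R) : ccont2 (fun _ _ => c) u v.
Proof. split; apply continuity_2d_pt_const. Qed.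

Lemma ccont2_plus (F G : R -> R -> C) (u v : R) :
  ccont2 F u v -> ccont2 G u v -> ccont2 (fun x y => Cplus (F x y) (G x y)) u v.
Proof. intros [H1 H2] [H3 H4]; split; simpl; now apply continuity_2d_pt_plus. Qed.

Lemma ccont2_mult (F G : R -> R -> C) (u v : R) :
  ccont2 F u v -> ccont2 G u v -> ccont2 (fun x y => Cmult (F x y) (G x y)) u v.
Proof.
intros [H1 H2] [H3 H4]; split; simpl.
- apply continuity_2d_pt_minus; now apply continuity_2d_pt_mult.
- apply continuity_2d_pt_plus; now apply continuity_2d_pt_mult.
Qed.

Lemma ccont2_csum {A : Type} (l : list A) (F : A -> R -> R -> C) (u v : R) :
  (forall i, In i l -> ccont2 (F i) u v) ->
  ccont2 (fun x y => csum l (fun i => F i x y)) u v.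
Proof.
induction l as [|i l IH]; intros H; [apply (ccont2_const (RtoC 0))|].
apply (ccont2_plus (F i)); [apply H; now left|].
apply IH; intros j Hj; apply H; now right.
Qed.

Lemma ccont2_comp (F : R -> C) (g : R -> R -> R) (u v : R) :
  ccont F (g u v) -> continuity_2d_pt g u v -> ccont2 (fun x y => F (g x y)) u v.
Proof.
intros [H1 H2] Hg; split.
- now apply (continuity_1d_2d_pt_comp (fun y => fst (F y))).
- now apply (continuity_1d_2d_pt_comp (fun y => snd (F y))).
Qed.

Lemma ccont2_sum_arg (F : R -> C) (u v : R) :
  ccont F (u + v) -> ccont2 (fun x y => F (x + y)) u v.
Proof.
intros H; apply (ccont2_comp F (fun x y => x + y)); trivial.
apply continuity_2d_pt_plus; [apply continuity_2d_pt_id1 | apply continuity_2d_pt_id2].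
Qed.

Lemma ccont2_swap (F : R -> R -> C) (u v : R) :
  ccont2 F v u -> ccont2 (fun x y => F y x) u v.
Proof.
intros [H1 H2]; split; intros eps.
- destruct (H1 eps) as [d Hd]; exists d; intros x y Hx Hy; now apply Hd.
- destruct (H2 eps) as [d Hd]; exists d; intros x y Hx Hy; now apply Hd.
Qed.

Section ComplexParametricIntegral.
Variables (b : R) (G : R -> R -> C).
Hypothesis G_cont : forall u v, hexagon b u v -> ccont2 G u v.

Lemma cderiv_cint_section (u v : R) :
  hexagon b u v -> cderiv (fun v => cint (G u) 0 v) v (G u v).
Proof.
intros H; split; simpl.
- apply (is_derive_RInt_section b (fun x y => fst (G x y))); trivial.
  intros x y Hxy; apply (G_cont x y Hxy).
- apply (is_derive_RInt_section b (fun x y => snd (G x y))); trivial.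
  intros x y Hxy; apply (G_cont x y Hxy).
Qed.

Lemma ccont2_cint_section (u v : R) :
  hexagon b u v -> ccont2 (fun u v => cint (G u) 0 v) u v.
Proof.
intros H; split; simpl.
- apply (continuity_2d_RInt_section b (fun x y => fst (G x y))); trivial.
  intros x y Hxy; apply (G_cont x y Hxy).
- apply (continuity_2d_RInt_section b (fun x y => snd (G x y))); trivial.
  intros x y Hxy; apply (G_cont x y Hxy).
Qed.

Lemma cderiv_cint_param (Gu : R -> R -> C) :
  (forall u v, hexagon b u v -> ccont2 Gu u v) ->
  (forall u v, hexagon b u v -> cderiv (fun z => G z v) u (Gu u v)) ->
  forall u v, hexagon b u v ->
  cderiv (fun z => cint (G z) 0 v) u (cint (Gu u) 0 v).
Proof.
intros Hc Hd u v H; split; simpl.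
- apply (is_derive_RInt_param_section b (fun x y => fst (G x y)))
    with (gu := fun x y => fst (Gu x y)); trivial; intros x y Hxy;
    [apply (G_cont x y Hxy) | apply (Hc x y Hxy) | apply (Hd x y Hxy)].
- apply (is_derive_RInt_param_section b (fun x y => snd (G x y)))
    with (gu := fun x y => snd (Gu x y)); trivial; intros x y Hxy;
    [apply (G_cont x y Hxy) | apply (Hc x y Hxy) | apply (Hd x y Hxy)].
Qed.

End ComplexParametricIntegral.

Lemma cint_ext (F G : R -> C) (a c : R) :
  (forall x, Rmin a c <= x <= Rmax a c -> F x = G x) -> cint F a c = cint G a c.
Proof.
intros H; unfold cint; f_equal; apply RInt_ext; intros x Hx; rewrite H; trivial; lra.
Qed.

Lemma cint_point (F : R -> C) (a : R) : cint F a a = RtoC 0.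
Proof. unfold cint; now rewrite !RInt_point. Qed.

Lemma cderiv_along_curve (G Gu : R -> R -> C) (x y : R -> R) (t dx dy : R) (gv : C) :
  locally_2d (fun u v => cderiv (fun z => G z v) u (Gu u v)) (x t) (y t) ->
  ccont2 Gu (x t) (y t) ->
  cderiv (fun z => G (x t) z) (y t) gv ->
  is_derive x t dx -> is_derive y t dy ->
  cderiv (fun s => G (x s) (y s)) t
    (Cplus (Cmult (RtoC dx) (Gu (x t) (y t))) (Cmult (RtoC dy) gv)).
Proof.
intros [d Hd] [C1 C2] [V1 V2] Hx Hy; split; simpl.
- evar_last.
  + apply (is_derive_along_curve (fun u v => fst (G u v)) (fun u v => fst (Gu u v)));
      [|exact C1 | exact V1 | exact Hx | exact Hy].
    exists d; intros u v Hu Hv; apply (Hd u v Hu Hv).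
  + simpl; ring.
- evar_last.
  + apply (is_derive_along_curve (fun u v => snd (G u v)) (fun u v => snd (Gu u v)));
      [|exact C2 | exact V2 | exact Hx | exact Hy].
    exists d; intros u v Hu Hv; apply (Hd u v Hu Hv).
  + simpl; ring.
Qed.

(** * Successive [u]-derivatives of a solution of the integral equation *)

Section Jets.
Variables (b : R) (N : nat) (q phi : nat -> R -> C) (H : R -> R -> C).
Hypothesis q_cont : forall k x, (k <= N)%nat -> Rabs x < b -> ccont (q k) x.
Hypothesis q_der :
  forall k x, (k < N)%nat -> Rabs x < b -> cderiv (q k) x (q (S k) x).
Hypothesis phi_cont : forall k x, (k <= N)%nat -> Rabs x < b -> ccont (phi k) x.
Hypothesis phi_der :
  forall k x, (k < N)%nat -> Rabs x < b -> cderiv (phi k) x (phi (S k) x).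
Hypothesis H_cont : forall u v, hexagon b u v -> ccont2 H u v.
Hypothesis H_der : forall u v, hexagon b u v ->
  cderiv (fun z => H z v) u
    (Cplus (phi 0%nat u) (cint (fun r => Cmult (q 0%nat (u + r)) (H u r)) 0 v)).

(** Iterating a total derivative operator makes the jets available as
    functions before differentiability is known. *)
Definition jet (d : nat) : R -> R -> C :=
  Nat.iter d (fun F u v => cDerive (fun z => F z v) u) H.

(** The [d]-th [u]-derivative of [q(u+v) H(u,v)], by the Leibniz formula. *)
Definition leib (d : nat) (u v : R) : C :=
  csum (seq 0 (S d)) (fun k =>
    Cmult (RtoC (Binomial.C d k)) (Cmult (q k (u + v)) (jet (d - k) u v))).

Lemma leib_cont (d : nat) (u v : R) :
  (d <= N)%nat -> hexagon b u v ->
  (forall j, (j <= d)%nat -> ccont2 (jet j) u v) -> ccont2 (leib d) u v.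
Proof.
intros Hd Huv Hj; apply (ccont2_csum (seq 0 (S d)) (fun k x y =>
  Cmult (RtoC (Binomial.C d k)) (Cmult (q k (x + y)) (jet (d - k) x y)))).
intros k Hk; apply in_seq in Hk.
apply (ccont2_mult (fun _ _ => RtoC (Binomial.C d k))); [apply ccont2_const|].
apply (ccont2_mult (fun x y => q k (x + y))); [|apply Hj; lia].
apply ccont2_sum_arg, q_cont; [lia | apply Huv].
Qed.

Lemma leib_der (d : nat) (u v : R) :
  (d < N)%nat -> hexagon b u v ->
  (forall j, (j <= d)%nat -> cderiv (fun z => jet j z v) u (jet (S j) u v)) ->
  cderiv (fun z => leib d z v) u (leib (S d) u v).
Proof.
intros Hd Huv Hj; eapply cderiv_eq.
- apply (cderiv_csum (seq 0 (S d)) (fun k z =>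
    Cmult (RtoC (Binomial.C d k)) (Cmult (q k (z + v)) (jet (d - k) z v)))).
  intros k Hk; apply in_seq in Hk.
  apply cderiv_mult_l, (cderiv_mult (fun z => q k (z + v))); [|apply Hj; lia].
  apply cderiv_shift, q_der; [lia | apply Huv].
- apply (leibniz_sum (fun k j => Cmult (q k (u + v)) (jet j u v))).
Qed.

(** The equation for [jet (S d)] is the one for [jet d] differentiated under
    the integral sign; its right-hand side only involves lower jets, so
    continuity and differentiability go up together. *)
Lemma jet_induction (d : nat) : (d <= N)%nat ->
  (forall j u v, (j <= S d)%nat -> hexagon b u v -> ccont2 (jet j) u v) /\
  (forall j u v, (j <= d)%nat -> hexagon b u v ->
     cderiv (fun z => jet j z v) u (jet (S j) u v) /\
     jet (S j) u v = Cplus (phi j u) (cint (leib j u) 0 v)).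
Proof.
(* The two properties at the next level follow from the derivative formula. *)
assert (Step : forall d, (d <= N)%nat ->
  (forall j u v, (j <= d)%nat -> hexagon b u v -> ccont2 (jet j) u v) ->
  (forall u v, hexagon b u v ->
     cderiv (fun z => jet d z v) u (Cplus (phi d u) (cint (leib d u) 0 v))) ->
  (forall u v, hexagon b u v ->
     ccont2 (jet (S d)) u v /\ cderiv (fun z => jet d z v) u (jet (S d) u v) /\
     jet (S d) u v = Cplus (phi d u) (cint (leib d u) 0 v))).
{ intros e He Hc Hder.
  assert (Heq : forall u v, hexagon b u v ->
    jet (S e) u v = Cplus (phi e u) (cint (leib e u) 0 v)).
  { intros u v Huv; exact (cDerive_unique _ _ _ (Hder u v Huv)). }
  intros u v Huv; split; [| split; [| now apply Heq]].
  - apply ccont2_ext_loc with (fun x y => Cplus (phi e x) (cint (leib e x) 0 y)).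
    + destruct (hexagon_open b u v Huv) as [dl Hdl]; exists dl.
      intros x y Hx Hy; symmetry; apply Heq; now apply Hdl.
    + apply (ccont2_plus (fun x _ => phi e x)).
      * apply (ccont2_comp (phi e) (fun x _ => x)); [|apply continuity_2d_pt_id1].
        apply phi_cont; [exact He | apply Huv].
      * apply (ccont2_cint_section b (leib e)); trivial.
        intros x y Hxy; apply leib_cont; trivial; intros j Hj; now apply Hc.
  - rewrite Heq by trivial; now apply Hder. }
induction d as [|d IH]; intros Hd.
- assert (S0 := Step 0%nat Hd).
  assert (H0 : forall u v, hexagon b u v ->
     cderiv (fun z => jet 0 z v) u (Cplus (phi 0%nat u) (cint (leib 0 u) 0 v))).
  { intros u v Huv; eapply cderiv_eq; [now apply H_der|]; f_equal.
    apply cint_ext; intros r _; unfold leib, csum; simpl.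
    rewrite C_n_0; ring. }
  assert (Hc0 : forall j u v, (j <= 0)%nat -> hexagon b u v -> ccont2 (jet j) u v).
  { intros j u v Hj Huv; replace j with 0%nat by lia; now apply H_cont. }
  split; intros j u v Hj Huv.
  + destruct (Nat.eq_dec j 1) as [-> | Hj1]; [now apply S0 | apply Hc0; trivial; lia].
  + replace j with 0%nat by lia; now apply S0.
- destruct (IH (Nat.le_trans _ _ _ (Nat.le_succ_diag_r d) Hd)) as [IHc IHd].
  assert (SS := Step (S d) Hd IHc).
  assert (HS : forall u v, hexagon b u v ->
     cderiv (fun z => jet (S d) z v) u
       (Cplus (phi (S d) u) (cint (leib (S d) u) 0 v))).
  { intros u v Huv.
    apply cderiv_ext_loc with (fun z => Cplus (phi d z) (cint (leib d z) 0 v)).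
    - pose proof (locally_section_l _ _ _ (hexagon_open b u v Huv)) as HL.
      revert HL; apply filter_imp; intros z Hz; symmetry; now apply (IHd d).
    - apply (cderiv_plus (phi d)); [apply phi_der; [lia | apply Huv]|].
      apply (cderiv_cint_param b (leib d)) with (Gu := leib (S d)); trivial;
        intros x y Hxy.
      + apply leib_cont; trivial; [lia|]; intros j Hj; apply IHc; trivial; lia.
      + apply leib_cont; trivial; intros j Hj; apply IHc; trivial; lia.
      + apply leib_der; trivial; intros j Hj; now apply (IHd j). }
  split; intros j u v Hj Huv.
  + destruct (Nat.eq_dec j (S (S d))) as [-> | Hj1];
      [now apply SS | apply IHc; trivial; lia].
  + destruct (Nat.eq_dec j (S d)) as [-> | Hj1];
      [now apply SS | apply IHd; trivial; lia].
Qed.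

Lemma jet_cont (d : nat) (u v : R) :
  (d <= S N)%nat -> hexagon b u v -> ccont2 (jet d) u v.
Proof. intros Hd; now apply (jet_induction N). Qed.

Lemma jet_der_u (d : nat) (u v : R) :
  (d <= N)%nat -> hexagon b u v ->
  cderiv (fun z => jet d z v) u (jet (S d) u v).
Proof. intros Hd Huv; now apply (jet_induction N). Qed.

Lemma jet_succ (d : nat) (u v : R) :
  (d <= N)%nat -> hexagon b u v ->
  jet (S d) u v = Cplus (phi d u) (cint (leib d u) 0 v).
Proof. intros Hd Huv; now apply (jet_induction N). Qed.

(** This is the mixed derivative eliminated through [H_uv = q H]. *)
Lemma jet_der_v (d : nat) (u v : R) :
  (d <= N)%nat -> hexagon b u v ->
  cderiv (fun z => jet (S d) u z) v (leib d u v).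
Proof.
intros Hd Huv.
apply cderiv_ext_loc with (fun z => Cplus (phi d u) (cint (leib d u) 0 z)).
- pose proof (locally_2d_1d_const_x _ _ _ (hexagon_open b u v Huv)) as HL.
  revert HL; apply filter_imp; intros z Hz; symmetry; now apply jet_succ.
- eapply cderiv_eq; [apply cderiv_plus; [apply cderiv_const|]|].
  + apply (cderiv_cint_section b (leib d)); trivial.
    intros x y Hxy; apply leib_cont; trivial; intros j Hj.
    apply jet_cont; trivial; lia.
  + ring.
Qed.

(** The curve is parametrized with a free slope [c] so that [c = 1/2] serves
    the [u]-derivatives and [c = -1/2] those in [v], after exchanging the
    variables. *)
Lemma jet_der_antidiagonal (d : nat) (c t : R) :
  (d < N)%nat -> hexagon b (c * t) (- c * t) ->
  cderiv (fun s => jet (S d) (c * s) (- c * s)) t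
    (Cmult (RtoC c)
       (Cminus (jet (S (S d)) (c * t) (- c * t)) (leib d (c * t) (- c * t)))).
Proof.
intros Hd Ht; eapply cderiv_eq.
- apply (cderiv_along_curve (jet (S d)) (jet (S (S d)))
           (fun s => c * s) (fun s => - c * s) t c (- c)).
  + destruct (hexagon_open b _ _ Ht) as [dl Hdl]; exists dl.
    intros u v Hu Hv; apply jet_der_u; [lia | now apply Hdl].
  + apply jet_cont; [lia | trivial].
  + apply jet_der_v; [lia | trivial].
  + auto_derive; [trivial | ring].
  + auto_derive; [trivial | ring].
- rewrite RtoC_opp; ring.
Qed.

Lemma jet_origin (d : nat) :
  (d <= N)%nat -> 0 < b -> jet (S d) 0 0 = phi d 0.
Proof.
intros Hd Hb; rewrite jet_succ, cint_point; trivial; [ring|].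
unfold hexagon; rewrite Rplus_0_r, Rabs_R0; tauto.
Qed.

End Jets.

(** * From derivatives along sets to the coordinatewise calculus *)

Lemma is_derive_C (F : R -> C) (x : R) (l : C) :
  is_derive (V := C_R_NormedModule) F x l <-> cderiv F x l.
Proof.
split.
- intros H; split.
  + apply (filterdiff_comp' (U := R_NormedModule) (V := C_R_NormedModule)
             (W := R_NormedModule) F fst x _ fst H).
    apply filterdiff_linear, is_linear_fst.
  + apply (filterdiff_comp' (U := R_NormedModule) (V := C_R_NormedModule)
             (W := R_NormedModule) F snd x _ snd H).
    apply filterdiff_linear, is_linear_snd.
- intros [H1 H2].
  assert (Hp : filterdiff (V := C_R_NormedModule)
                 (fun y => (fst (F y), snd (F y))) (locally x)
                 (fun y : R => (scal y (fst l), scal y (snd l)))).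
  { apply (filterdiff_comp'_2 (T := R_NormedModule) (U := R_NormedModule)
             (V := R_NormedModule) (W := C_R_NormedModule)
             _ _ (fun a c => (a, c)) x _ _ (fun a c => (a, c)) H1 H2).
    eapply filterdiff_ext; [|eapply filterdiff_ext_lin; [apply filterdiff_id|]];
      now intros [? ?]. }
  eapply filterdiff_ext; [|exact Hp].
  intros y; symmetry; apply surjective_pairing.
Qed.

(** At an interior point of [A] the restriction of the filter to [A] has no
    effect. *)
Lemma is_derive_on_cderiv (A : R -> Prop) (F : R -> C) (x : R) (l : C) :
  locally x A -> is_derive_on A F x l -> cderiv F x l.
Proof.
intros HA [Hl HF]; apply is_derive_C; split; [exact Hl|].
intros y Hy eps.
assert (Hy' : is_filter_lim (within A (locally x)) y).
{ intros P HP; apply Hy in HP; unfold within; revert HP; apply filter_imp.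
  now intros z Hz _. }
pose proof (filter_and _ _ HA (HF y Hy' eps)) as HL; revert HL.
apply filter_imp; intros z [Hz HI]; exact (HI Hz).
Qed.

Lemma within_locally_proper (A : R -> Prop) (x : R) :
  A x -> ProperFilter (within A (locally x)).
Proof.
intros HA; split; [|apply within_filter, locally_filter].
intros P HP; exists x; exact (locally_singleton _ _ HP HA).
Qed.

Lemma cderiv_is_derive_on (A : R -> Prop) (F : R -> C) (x : R) (l : C) :
  A x -> cderiv F x l -> is_derive_on A F x l.
Proof.
intros HA HF; apply is_derive_C in HF.
pose proof (within_locally_proper A x HA) as PF.
apply (filterdiff_locally F x); [|exact HF].
intros P HP; unfold within; revert HP; apply filter_imp; tauto.
Qed.

Lemma cderiv_unique (F : R -> C) (x : R) (l m : C) :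
  cderiv F x l -> cderiv F x m -> l = m.
Proof.
intros Hl Hm; now rewrite <- (cDerive_unique _ _ _ Hl), <- (cDerive_unique _ _ _ Hm).
Qed.

Lemma derive_on_cderiv (A : R -> Prop) (F : R -> C) (x : R) :
  locally x A -> ex_derive_on A F x -> cderiv F x (derive_on A F x).
Proof.
intros HA [l Hl]; pose proof (is_derive_on_cderiv A F x l HA Hl) as Hd.
replace (derive_on A F x) with l; [exact Hd|].
symmetry; apply (iota_unique (V := C_R_CompleteNormedModule)); [|exact Hl].
intros m Hm; apply (cderiv_unique F x); [|exact Hd].
now apply is_derive_on_cderiv with A.
Qed.

Lemma locally_Icc (b x : R) : Rabs x < b -> locally x (Icc (- b) b).
Proof.
intros Hx; assert (Hd : 0 < b - Rabs x) by lra.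
exists (mkposreal _ Hd); intros y Hy; change (Rabs (y - x) < b - Rabs x) in Hy.
pose proof (Rabs_triang_inv y x) as HT.
assert (Hyb : Rabs y <= b) by lra.
now apply Rabs_le_between in Hyb.
Qed.

Lemma continuous_ccont (F : R -> C) (x : R) :
  continuous (U := C_UniformSpace) F x -> ccont F x.
Proof.
intros H; split; apply continuity_pt_filterlim.
- apply (continuous_comp (V := C_UniformSpace) F fst); trivial; apply continuous_fst.
- apply (continuous_comp (V := C_UniformSpace) F snd); trivial; apply continuous_snd.
Qed.

Lemma continuous_ccont2 (F : R -> R -> C) (u v : R) :
  continuous (T := prod_UniformSpace R_UniformSpace R_UniformSpace)
    (U := C_UniformSpace) (fun p => F (fst p) (snd p)) (u, v) -> ccont2 F u v.
Proof.
intros H; split; apply continuity_2d_pt_filterlim.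
- apply (continuous_comp (U := prod_UniformSpace R_UniformSpace R_UniformSpace)
    (V := C_UniformSpace) (fun p => F (fst p) (snd p)) fst); trivial.
  apply continuous_fst.
- apply (continuous_comp (U := prod_UniformSpace R_UniformSpace R_UniformSpace)
    (V := C_UniformSpace) (fun p => F (fst p) (snd p)) snd); trivial.
  apply continuous_snd.
Qed.

Lemma Ck_on_cderiv (b : R) (k j : nat) (q : R -> C) (x : R) :
  Ck_on (Icc (- b) b) k q -> (j < k)%nat -> Rabs x < b ->
  cderiv (derive_n_on (Icc (- b) b) q j) x (derive_n_on (Icc (- b) b) q (S j) x).
Proof.
intros [Hd _] Hj Hx; pose proof (locally_Icc b x Hx) as HL.
apply derive_on_cderiv; trivial.
apply Hd; trivial; now apply locally_singleton in HL.
Qed.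

Lemma Ck_on_ccont (b : R) (k j : nat) (q : R -> C) (x : R) :
  Ck_on (Icc (- b) b) k q -> (j <= k)%nat -> Rabs x < b ->
  ccont (derive_n_on (Icc (- b) b) q j) x.
Proof.
intros HC Hj Hx; destruct (Nat.eq_dec j k) as [-> | Hjk].
- apply continuous_ccont.
  apply (continuous_continuous_on (T := R_UniformSpace) (U := C_UniformSpace)
           (Icc (- b) b)); [now apply locally_Icc | apply HC].
- apply (cderiv_ccont _ _ (derive_n_on (Icc (- b) b) q (S j) x)).
  apply Ck_on_cderiv with k; trivial; lia.
Qed.

(** * The Goursat problem as a pair of integral equations *)

Lemma cint_FTC (F F' : R -> C) (a c : R) :
  (forall x, Rmin a c <= x <= Rmax a c -> cderiv F x (F' x)) ->
  (forall x, Rmin a c <= x <= Rmax a c -> ccont F' x) ->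
  F c = Cplus (F a) (cint F' a c).
Proof.
intros Hd Hc.
assert (E1 : is_RInt (fun y => fst (F' y)) a c (fst (F c) - fst (F a))).
{ apply (is_RInt_derive (fun y => fst (F y))).
  - intros x Hx; apply (Hd x Hx).
  - intros x Hx; apply continuity_pt_filterlim, (Hc x Hx). }
assert (E2 : is_RInt (fun y => snd (F' y)) a c (snd (F c) - snd (F a))).
{ apply (is_RInt_derive (fun y => snd (F y))).
  - intros x Hx; apply (Hd x Hx).
  - intros x Hx; apply continuity_pt_filterlim, (Hc x Hx). }
rewrite (surjective_pairing (F c)); unfold cint, Cplus; simpl.
rewrite (is_RInt_unique _ _ _ _ E1), (is_RInt_unique _ _ _ _ E2).
f_equal; ring.
Qed.

Lemma RInt_C_cint (F : R -> C) (a c : R) :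
  (forall x, Rmin a c <= x <= Rmax a c -> ccont F x) ->
  RInt (V := C_R_CompleteNormedModule) F a c = cint F a c.
Proof.
intros Hc; apply is_RInt_unique.
apply (is_RInt_fct_extend_pair (U := R_NormedModule) (V := R_NormedModule));
  apply (RInt_correct (V := R_CompleteNormedModule)),
        (ex_RInt_continuous (V := R_CompleteNormedModule));
  intros x Hx; apply continuity_pt_filterlim, (Hc x Hx).
Qed.

Section Goursat.
Variables (b : R) (q : R -> C) (h : C) (H : R -> R -> C).
Hypothesis q_cont : forall x, Rabs x < b -> ccont q x.
Hypothesis sol : goursat_solution b q h H.

Let qH (u v : R) : C := Cmult (q (u + v)) (H u v).

Lemma hexagon_domain (u v : R) : hexagon b u v -> goursat_domain b u v.
Proof. unfold hexagon, goursat_domain; lra. Qed.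

Lemma goursat_slice_u (u v : R) :
  hexagon b u v -> locally u (fun x => goursat_domain b x v).
Proof.
intros Huv; pose proof (locally_section_l _ _ _ (hexagon_open b u v Huv)) as HL.
revert HL; apply filter_imp; intros x; apply hexagon_domain.
Qed.

Lemma goursat_slice_v (u v : R) :
  hexagon b u v -> locally v (fun y => goursat_domain b u y).
Proof.
intros Huv; pose proof (locally_2d_1d_const_x _ _ _ (hexagon_open b u v Huv)) as HL.
revert HL; apply filter_imp; intros x; apply hexagon_domain.
Qed.

Lemma H_cont_hexagon (u v : R) : hexagon b u v -> ccont2 H u v.
Proof.
intros Huv; apply continuous_ccont2.
apply (continuous_continuous_on
         (T := prod_UniformSpace R_UniformSpace R_UniformSpace)
         (U := C_UniformSpace)
         (fun p => goursat_domain b (fst p) (snd p))).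
- apply (locally_2d_locally (goursat_domain b)).
  destruct (hexagon_open b u v Huv) as [d Hd]; exists d.
  intros x y Hx Hy; now apply hexagon_domain, Hd.
- apply (goursat_continuous _ _ _ _ sol).
Qed.

Lemma qH_cont_hexagon (u v : R) : hexagon b u v -> ccont2 qH u v.
Proof.
intros Huv; apply (ccont2_mult (fun x y => q (x + y))); [|now apply H_cont_hexagon].
apply ccont2_sum_arg, q_cont, Huv.
Qed.

Lemma qH_cont_swap (u v : R) : hexagon b u v -> ccont2 (fun x y => qH y x) u v.
Proof. intros Huv; now apply ccont2_swap, qH_cont_hexagon, hexagon_sym. Qed.

Lemma ccont2_section_r (F : R -> R -> C) (u v : R) : ccont2 F u v -> ccont (F u) v.
Proof.
intros [H1 H2]; split; apply continuity_pt_filterlim.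
- now apply (continuity_2d_section_r (fun x y => fst (F x y))).
- now apply (continuity_2d_section_r (fun x y => snd (F x y))).
Qed.

Lemma H_der_v_Dv (u v : R) :
  hexagon b u v -> cderiv (fun z => H u z) v (Dv b H u v).
Proof.
intros Huv; apply (derive_on_cderiv (fun z => goursat_domain b u z) (fun z => H u z)).
- now apply goursat_slice_v.
- apply (goursat_ex_Dv _ _ _ _ sol); now apply hexagon_domain.
Qed.

(** [Dv] vanishes on the axis [u = 0], where [H] is constant, so integrating
    the differential equation from that axis recovers it. *)
Lemma Dv_integral (u v : R) :
  hexagon b u v -> Dv b H u v = cint (fun s => Cmult (q (s + v)) (H s v)) 0 u.
Proof.
intros Huv; apply hexagon_sym in Huv.
assert (Seg : forall s, Rmin 0 u <= s <= Rmax 0 u -> hexagon b v s)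
  by (intros s Hs; now apply hexagon_segment with u).
assert (Hv0 : hexagon b 0 v).
{ apply hexagon_sym, Seg; unfold Rmin, Rmax; destruct (Rle_dec 0 u); lra. }
rewrite (cint_FTC (fun s => Dv b H s v) (fun s => Cmult (q (s + v)) (H s v)) 0 u).
- replace (Dv b H 0 v) with (RtoC 0); [ring|].
  apply (cderiv_unique (fun z => H 0 z) v); [|now apply H_der_v_Dv].
  apply cderiv_ext_loc with (fun _ => Cdiv h (RtoC 2)); [|apply cderiv_const].
  pose proof (goursat_slice_v _ _ Hv0) as HL; revert HL; apply filter_imp.
  intros z Hz; symmetry; apply (goursat_boundary_v _ _ _ _ sol), Hz.
- intros s Hs; specialize (Seg s Hs); apply hexagon_sym in Seg.
  apply (is_derive_on_cderiv (fun u' => goursat_domain b u' v)).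
  + now apply goursat_slice_u.
  + apply (goursat_equation _ _ _ _ sol); now apply hexagon_domain.
- intros s Hs; specialize (Seg s Hs).
  exact (ccont2_section_r _ _ _ (qH_cont_swap v s Seg)).
Qed.

Lemma H_der_v (u v : R) : hexagon b u v ->
  cderiv (fun z => H u z) v (cint (fun s => Cmult (q (s + v)) (H s v)) 0 u).
Proof. intros Huv; rewrite <- Dv_integral by trivial; now apply H_der_v_Dv. Qed.

(** The Goursat problem controls [Dv] along slices only; its joint continuity
    comes from the integral formula. *)
Lemma Dv_cont (u v : R) : hexagon b u v -> ccont2 (Dv b H) u v.
Proof.
intros Huv.
apply ccont2_ext_loc with (fun x y => cint (fun s => qH s y) 0 x).
- destruct (hexagon_open b u v Huv) as [d Hd]; exists d.
  intros x y Hx Hy; symmetry; apply Dv_integral; now apply Hd.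
- apply (ccont2_swap (fun y x => cint (fun s => qH s y) 0 x)).
  apply (ccont2_cint_section b (fun y s => qH s y)); [|now apply hexagon_sym].
  exact qH_cont_swap.
Qed.

Lemma Dv_der_u (u v : R) : hexagon b u v ->
  cderiv (fun z => Dv b H z v) u (Cmult (q (u + v)) (H u v)).
Proof.
intros Huv; apply (is_derive_on_cderiv (fun u' => goursat_domain b u' v)).
- now apply goursat_slice_u.
- apply (goursat_equation _ _ _ _ sol); now apply hexagon_domain.
Qed.

(** Integrate [Dv] from the axis [v = 0], where [H] is given by [q], and
    differentiate under the integral sign. *)
Lemma H_der_u (u v : R) : hexagon b u v ->
  cderiv (fun z => H z v) u
    (Cplus (Cmult (RtoC (/ 2)) (q u))
       (cint (fun r => Cmult (q (u + r)) (H u r)) 0 v)).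
Proof.
intros Huv.
apply cderiv_ext_loc with (fun z =>
  Cplus (Cplus (Cdiv h (RtoC 2)) (Cmult (RtoC (/ 2)) (cint q 0 z)))
        (cint (Dv b H z) 0 v)).
- pose proof (locally_section_l _ _ _ (hexagon_open b u v Huv)) as HL.
  revert HL; apply filter_imp; intros z Hz.
  rewrite (cint_FTC (fun y => H z y) (Dv b H z) 0 v).
  + f_equal.
    rewrite (goursat_boundary_u _ _ _ _ sol) by (destruct Hz; lra).
    rewrite RInt_C_cint; [reflexivity|].
    intros x Hx; apply q_cont.
    pose proof (hexagon_segment b 0 z x) as HS; unfold hexagon in HS.
    rewrite Rplus_0_l, Rabs_R0 in HS.
    destruct Hz as [Hz _]; pose proof (Rabs_pos z); apply HS; trivial; lra.
  + intros y Hy; apply H_der_v_Dv; now apply hexagon_segment with v.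
  + intros y Hy; apply ccont2_section_r, Dv_cont; now apply hexagon_segment with v.
- apply cderiv_plus.
  + eapply cderiv_eq.
    * apply cderiv_plus; [apply cderiv_const|].
      apply cderiv_mult_l.
      apply (cderiv_cint_section b (fun _ s => q s)) with (u := 0);
        [|unfold hexagon; rewrite Rplus_0_l, Rabs_R0; destruct Huv as [Hu _];
          pose proof (Rabs_pos u); repeat split; trivial; lra].
      intros x y Hxy; apply (ccont2_comp q (fun _ y => y));
        [|apply continuity_2d_pt_id2].
      apply q_cont, Hxy.
    * ring.
  + apply (cderiv_cint_param b (Dv b H)) with (Gu := qH); trivial.
    * exact Dv_cont.
    * exact qH_cont_hexagon.
    * exact Dv_der_u.
Qed.

End Goursat.

(** * Removing one value from a sorted list *)

Fixpoint insert (k : nat) (ns : list nat) : list nat :=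
  match ns with
  | [] => [k]
  | x :: ns' => if (k <=? x)%nat then k :: ns else x :: insert k ns'
  end.

Lemma remove_first_insert (k : nat) (ns : list nat) :
  remove_first k (insert k ns) = ns.
Proof.
induction ns as [|x ns IH]; simpl; [now rewrite Nat.eqb_refl|].
destruct (Nat.leb_spec k x); simpl; [now rewrite Nat.eqb_refl|].
destruct (Nat.eqb_spec x k); [lia | now rewrite IH].
Qed.

Lemma insert_perm (k : nat) (ns : list nat) : Permutation (insert k ns) (k :: ns).
Proof.
induction ns as [|x ns IH]; simpl; [reflexivity|].
destruct (k <=? x)%nat; [reflexivity|].
rewrite IH; apply perm_swap.
Qed.

Lemma insert_sorted (k : nat) (ns : list nat) :
  Sorted le ns -> Sorted le (insert k ns).
Proof.
induction 1 as [|x ns Hs IH Hx]; simpl; [repeat constructor|].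
destruct (Nat.leb_spec k x).
- repeat constructor; trivial.
- constructor; [exact IH|].
  destruct ns as [|y ns]; simpl; [constructor; lia|].
  inversion Hx; destruct (k <=? y)%nat; constructor; lia.
Qed.

Lemma insert_remove_first (k : nat) (ns : list nat) :
  Sorted le ns -> In k ns -> insert k (remove_first k ns) = ns.
Proof.
intros Hs; apply Sorted_StronglySorted in Hs; [|intros ?; lia].
induction Hs as [|x ns Hs IH Hx]; intros Hk; [destruct Hk|]; simpl.
destruct (Nat.eqb_spec x k) as [-> | Hne].
- destruct ns as [|y ns]; simpl; trivial.
  inversion Hx; subst; destruct (Nat.leb_spec k y); trivial; lia.
- destruct Hk as [Hk | Hk]; [contradiction|]; simpl.
  rewrite Forall_forall in Hx; specialize (Hx k Hk).
  destruct (Nat.leb_spec k x); [lia | now rewrite IH].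
Qed.

Lemma remove_first_perm (k : nat) (ns : list nat) :
  In k ns -> Permutation ns (k :: remove_first k ns).
Proof.
induction ns as [|x ns IH]; intros Hk; [destruct Hk|]; simpl.
destruct (Nat.eqb_spec x k) as [-> | Hne]; [reflexivity|].
destruct Hk as [Hk | Hk]; [contradiction|].
rewrite (IH Hk) at 1; apply perm_swap.
Qed.

Lemma remove_first_sorted (k : nat) (ns : list nat) :
  Sorted le ns -> Sorted le (remove_first k ns).
Proof.
intros Hs; apply Sorted_StronglySorted in Hs; [|intros ?; lia].
apply StronglySorted_Sorted.
induction Hs as [|x ns Hs IH Hx]; simpl; [constructor|].
destruct (x =? k)%nat; [exact Hs|]; constructor; [exact IH|].
rewrite Forall_forall in *; intros y Hy; apply Hx.
clear - Hy; induction ns as [|z ns IH]; simpl in *; [exact Hy|].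
destruct (z =? k)%nat; [now right | destruct Hy; [now left | right; auto]].
Qed.

Lemma list_sum_perm (ns ms : list nat) : Permutation ns ms -> list_sum ns = list_sum ms.
Proof. induction 1; simpl; lia. Qed.

Lemma Clist_prod_perm (zs ws : list C) :
  Permutation zs ws -> Clist_prod zs = Clist_prod ws.
Proof.
induction 1 as [| z zs ws _ IH | y z zs | zs ws xs _ IH1 _ IH2]; simpl; trivial.
- now rewrite IH.
- ring.
- now rewrite IH1.
Qed.

Lemma sum_lists_insert (k l m : nat) (ns : list nat) :
  (In ns (sum_lists (S l) m) /\ In k ns) <->
  (k <= m)%nat /\ exists ns', In ns' (sum_lists l (m - k)) /\ ns = insert k ns'.
Proof.
split.
- intros [Hns Hk]; apply in_sum_lists in Hns; destruct Hns as [Hl [Hs Hm]].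
  pose proof (remove_first_perm k ns Hk) as HP.
  pose proof (Permutation_length HP) as HPl; pose proof (list_sum_perm _ _ HP) as HPs.
  simpl in HPl, HPs; split; [lia|].
  exists (remove_first k ns); split; [|symmetry; now apply insert_remove_first].
  apply in_sum_lists; repeat split; [lia | now apply remove_first_sorted | lia].
- intros [Hkm [ns' [Hns' ->]]]; apply in_sum_lists in Hns'.
  destruct Hns' as [Hl [Hs Hm]].
  pose proof (insert_perm k ns') as HP.
  pose proof (Permutation_length HP) as HPl; pose proof (list_sum_perm _ _ HP) as HPs.
  simpl in HPl, HPs; split.
  + apply in_sum_lists; repeat split; [lia | now apply insert_sorted | lia].
  + apply (Permutation_in k (Permutation_sym HP)); now left.
Qed.

Lemma NoDup_flat_map_key {A B : Type} (key : B -> A) (f : A -> list B) (l : list A) :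
  NoDup l -> (forall x, NoDup (f x)) ->
  (forall x y, In y (f x) -> key y = x) -> NoDup (flat_map f l).
Proof.
intros Hl Hf Hk; induction Hl as [|x l Hx Hl IH]; simpl; [constructor|].
apply NoDup_app; trivial.
intros y Hy Hy'; apply in_flat_map in Hy'; destruct Hy' as [x' [Hx' Hy']].
apply Hx; now rewrite <- (Hk x y Hy), (Hk x' y Hy').
Qed.

(** Choosing a sorted list and one of its distinct values amounts to choosing
    the value and then, freely, the sorted list that remains. *)
Lemma csum_remove_first (l m : nat) (G : nat -> list nat -> C) :
  csum (sum_lists (S l) m) (fun ns =>
    csum (nodup Nat.eq_dec ns) (fun k => G k (remove_first k ns))) =
  csum (seq 0 (S m)) (fun k => csum (sum_lists l (m - k)) (G k)).
Proof.
set (L := flat_map (fun ns => map (fun k => (k, ns)) (nodup Nat.eq_dec ns))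
            (sum_lists (S l) m)).
set (R := flat_map (fun k => map (fun ns => (k, ns)) (sum_lists l (m - k)))
            (seq 0 (S m))).
set (ins := fun p : nat * list nat => (fst p, insert (fst p) (snd p))).
transitivity (csum L (fun p => G (fst p) (remove_first (fst p) (snd p)))).
{ unfold L; rewrite csum_flat_map; apply csum_ext; intros ns _; now rewrite csum_map. }
transitivity (csum (map ins R) (fun p => G (fst p) (remove_first (fst p) (snd p)))).
2:{ rewrite csum_map; unfold R; rewrite csum_flat_map; apply csum_ext; intros k _.
    rewrite csum_map; apply csum_ext; intros ns _; simpl.
    now rewrite remove_first_insert. }
apply csum_perm, NoDup_Permutation.
- apply (NoDup_flat_map_key snd).
  + apply NoDup_sum_lists.
  + intros ns; apply FinFun.Injective_map_NoDup; [|apply NoDup_nodup].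
    intros k k' E; now injection E.
  + intros ns p Hp; apply in_map_iff in Hp; now destruct Hp as [k [<- _]].
- apply FinFun.Injective_map_NoDup.
  + intros [k ns] [k' ns'] E; injection E as <- E; f_equal.
    now rewrite <- (remove_first_insert k ns), E, remove_first_insert.
  + apply (NoDup_flat_map_key fst).
    * apply seq_NoDup.
    * intros k; apply FinFun.Injective_map_NoDup; [|apply NoDup_sum_lists].
      intros ns ns' E; now injection E.
    * intros k p Hp; apply in_map_iff in Hp; now destruct Hp as [ns [<- _]].
- intros [k ns]; transitivity (In ns (sum_lists (S l) m) /\ In k ns).
  + unfold L; rewrite in_flat_map; split.
    * intros [ns0 [Hns0 HI]]; apply in_map_iff in HI.
      destruct HI as [k0 [E Hk0]]; injection E as -> ->.
      now apply nodup_In in Hk0.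
    * intros [Hns Hk]; exists ns; split; trivial.
      apply in_map_iff; exists k; split; trivial; now apply nodup_In.
  + rewrite sum_lists_insert; unfold R; rewrite in_map_iff; split.
    * intros [Hkm [ns' [Hns' ->]]]; exists (k, ns'); split; trivial.
      apply in_flat_map; exists k; split; [apply in_seq; lia | now apply in_map].
    * intros [[k0 ns0] [E HI]]; injection E as -> <-.
      apply in_flat_map in HI; destruct HI as [k1 [Hk1 HI]].
      apply in_map_iff in HI; destruct HI as [ns1 [E Hns1]]; injection E as -> ->.
      apply in_seq in Hk1; split; [lia|]; now exists ns0.
Qed.

(** * The recursion of the coefficients, summed over lists and lengths *)

Lemma RtoC_m1 : RtoC (-1) = Copp (RtoC 1).
Proof. apply RtoC_opp. Qed.

Lemma csum_seq_extend (n m : nat) (F : nat -> C) :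
  (n <= m)%nat -> (forall k, (n <= k)%nat -> F k = RtoC 0) ->
  csum (seq 0 m) F = csum (seq 0 n) F.
Proof.
intros Hnm HF; induction Hnm as [|m Hnm IH]; trivial.
rewrite csum_seq_last, IH, HF by trivial; ring.
Qed.

(** Summation over the triangle [d + k < m], along its diagonals on the
    left. *)
Lemma csum_triangle (m : nat) (g : nat -> nat -> C) :
  csum (seq 0 m) (fun D => csum (seq 0 (S D)) (fun k => g (D - k)%nat k)) =
  csum (seq 0 m) (fun k => csum (seq 0 (m - k)) (fun d => g d k)).
Proof.
induction m as [|m IH]; [reflexivity|].
rewrite csum_seq_last, IH.
transitivity (csum (seq 0 (S m)) (fun k =>
  Cplus (csum (seq 0 (m - k)) (fun d => g d k)) (g (m - k)%nat k))).
- rewrite csum_plus, (csum_seq_last m (fun k => csum (seq 0 (m - k)) (fun d => g d k))).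
  rewrite Nat.sub_diag; change (csum (seq 0 0) (fun d => g d m)) with (RtoC 0); ring.
- apply csum_ext; intros k Hk; apply in_seq in Hk.
  now rewrite Nat.sub_succ_l, csum_seq_last by lia.
Qed.

Lemma RtoC_Rlist_sum {A : Type} (l : list A) (F : A -> R) :
  RtoC (Rlist_sum (map F l)) = csum l (fun x => RtoC (F x)).
Proof.
induction l as [|x l IH]; [reflexivity|].
rewrite csum_cons, <- IH, <- RtoC_plus; reflexivity.
Qed.

Lemma Scoef_inadmissible (n l d : nat) (ns : list nat) :
  (n < d + 2 * l)%nat -> Scoef n l d ns = 0.
Proof.
intros Hn; assert (E : admissible n l d ns = false).
{ apply Bool.not_true_iff_false; unfold admissible.
  rewrite !Bool.andb_true_iff, !Nat.leb_le; lia. }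
destruct n; simpl; now rewrite E.
Qed.

(** The factor [eps] of the recursion: both derivatives of order 0 are [H]
    itself, so the term of order 0 counts [1 + (-1)^m] times when it produces a
    first derivative. *)
Definition epsilon (m d : nat) : R := if (d =? 1)%nat then 1 + (-1) ^ m else 1.

Lemma Scoef_succ (m l d : nat) (ns : list nat) :
  (d + 2 * l <= S m)%nat -> In ns (sum_lists l (S m - d - 2 * l)) ->
  Scoef (S m) l d ns =
  epsilon m d * match d with O => 0 | S d' => Scoef m l d' ns end +
  Rlist_sum (map (fun k => Binomial.C (d + k) k *
                           Scoef m (l - 1) (d + k + 1) (remove_first k ns))
                 (nodup Nat.eq_dec ns)).
Proof.
intros Hd Hns; apply in_sum_lists in Hns; destruct Hns as [Hl [Hs Hsum]].
assert (E : admissible (S m) l d ns = true).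
{ unfold admissible; apply nondecreasingP in Hs.
  rewrite !Bool.andb_true_iff, !Nat.leb_le, !Nat.eqb_eq; repeat split; trivial; lia. }
cbn [Scoef]; now rewrite E.
Qed.

Section Coefficients.
Variable Q : nat -> C.

(** With [Q k = q^(k)(0)], this is the contribution to the coefficient of the
    derivative of order [d] in [(d_u - d_v)^n H] of the products of [l] factors
    [Q], without its sign [(-1)^l]. *)
Definition list_coef (n l d : nat) : C :=
  csum (sum_lists l (n - d - 2 * l)) (fun ns =>
    Cmult (RtoC (Scoef n l d ns)) (Clist_prod (map Q ns))).

(** Values [l > n/2] contribute 0, and the longer range makes the ranges for
    [n] and [S n] fit together. *)
Definition order_coef (n d : nat) : C :=
  csum (seq 0 (S n)) (fun l => Cmult (RtoC ((-1) ^ l)) (list_coef n l d)).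

Lemma list_coef_0 (n l d : nat) :
  (n < d + 2 * l)%nat -> list_coef n l d = RtoC 0.
Proof.
intros Hn; apply csum_0; intros ns _; rewrite Scoef_inadmissible by lia; ring.
Qed.

Lemma order_coef_0 (n d : nat) : (n < d)%nat -> order_coef n d = RtoC 0.
Proof. intros Hn; apply csum_0; intros l _; rewrite list_coef_0 by lia; ring. Qed.

Lemma list_coef_succ (m l d : nat) :
  list_coef (S m) l d =
  Cplus (match d with
         | O => RtoC 0
         | S d' => Cmult (RtoC (epsilon m d)) (list_coef m l d')
         end)
        (match l with
         | O => RtoC 0
         | S l' => csum (seq 0 (S m)) (fun k =>
             Cmult (RtoC (Binomial.C (d + k) k))
               (Cmult (Q k) (list_coef m l' (d + k + 1))))
         end).
Proof.
destruct (le_lt_dec (d + 2 * l) (S m)) as [Hd | Hd].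
2:{ rewrite list_coef_0 by lia.
    replace (match d with O => RtoC 0 | S d' => _ end) with (RtoC 0)
      by (destruct d; [reflexivity | rewrite list_coef_0 by lia; ring]).
    destruct l as [|l]; [ring|].
    rewrite csum_0; [ring|]; intros k _; rewrite list_coef_0 by lia; ring. }
set (M := (S m - d - 2 * l)%nat).
transitivity (Cplus
  (csum (sum_lists l M) (fun ns =>
     Cmult (RtoC (epsilon m d * match d with O => 0 | S d' => Scoef m l d' ns end))
       (Clist_prod (map Q ns))))
  (csum (sum_lists l M) (fun ns =>
     csum (nodup Nat.eq_dec ns) (fun k =>
       Cmult (RtoC (Binomial.C (d + k) k))
         (Cmult (Q k)
           (Cmult (RtoC (Scoef m (l - 1) (d + k + 1) (remove_first k ns)))
             (Clist_prod (map Q (remove_first k ns))))))))).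
{ rewrite <- csum_plus; apply csum_ext; intros ns Hns.
  rewrite Scoef_succ by trivial.
  rewrite RtoC_plus, RtoC_Rlist_sum, Cmult_plus_distr_r; f_equal.
  rewrite Cmult_comm, <- csum_mult_l; apply csum_ext; intros k Hk.
  apply nodup_In in Hk.
  rewrite (Clist_prod_perm _ _ (Permutation_map Q (remove_first_perm k ns Hk))).
  simpl Clist_prod; rewrite RtoC_mult; ring. }
f_equal.
- destruct d as [|d'].
  + apply csum_0; intros; rewrite Rmult_0_r; ring.
  + unfold list_coef; rewrite <- csum_mult_l.
    replace (m - d' - 2 * l)%nat with M by (unfold M; lia).
    apply csum_ext; intros ns _; rewrite RtoC_mult; ring.
- destruct l as [|l'].
  + apply csum_0; intros ns Hns; apply in_sum_lists in Hns.
    destruct Hns as [Hl _]; now destruct ns.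
  + rewrite (csum_remove_first l' M (fun k ns =>
      Cmult (RtoC (Binomial.C (d + k) k))
         (Cmult (Q k)
           (Cmult (RtoC (Scoef m (S l' - 1) (d + k + 1) ns)) (Clist_prod (map Q ns)))))).
    rewrite (csum_seq_extend (S M) (S m)); [|unfold M; lia|].
    * apply csum_ext; intros k Hk; apply in_seq in Hk.
      rewrite !csum_mult_l; unfold list_coef.
      replace (S l' - 1)%nat with l' by lia.
      now replace (m - (d + k + 1) - 2 * l')%nat with (M - k)%nat by (unfold M; lia).
    * intros k Hk; unfold M in Hk; rewrite list_coef_0 by lia; ring.
Qed.

Lemma order_coef_succ (m d : nat) :
  order_coef (S m) d =
  Cminus (match d with
          | O => RtoC 0
          | S d' => Cmult (RtoC (epsilon m d)) (order_coef m d')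
          end)
         (csum (seq 0 (S m)) (fun k =>
            Cmult (RtoC (Binomial.C (d + k) k))
              (Cmult (Q k) (order_coef m (d + k + 1))))).
Proof.
unfold order_coef at 1.
rewrite (csum_ext _ _ _ (fun l _ => f_equal (Cmult _) (list_coef_succ m l d))).
rewrite (csum_ext _ _ _ (fun l _ => Cmult_plus_distr_l _ _ _)), csum_plus.
unfold Cminus; f_equal.
- destruct d as [|d']; [apply csum_0; intros; ring|].
  unfold order_coef; rewrite <- csum_mult_l.
  rewrite csum_seq_last, list_coef_0, Cmult_0_r, Cmult_0_r, Cplus_0_r by lia.
  apply csum_ext; intros; ring.
- rewrite csum_seq_first, Cmult_0_r, Cplus_0_l.
  transitivity (csum (seq 0 (S m)) (fun l => csum (seq 0 (S m)) (fun k =>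
    Copp (Cmult (RtoC (Binomial.C (d + k) k)) (Cmult (Q k)
      (Cmult (RtoC ((-1) ^ l)) (list_coef m l (d + k + 1)))))))).
  + apply csum_ext; intros l _; rewrite <- csum_mult_l; apply csum_ext; intros k _.
    change ((-1) ^ S l) with (-1 * (-1) ^ l); rewrite RtoC_mult, RtoC_m1; ring.
  + rewrite csum_switch.
    replace (Copp (csum _ _)) with (Cmult (RtoC (-1))
      (csum (seq 0 (S m)) (fun k => Cmult (RtoC (Binomial.C (d + k) k))
              (Cmult (Q k) (order_coef m (d + k + 1))))))
      by (rewrite RtoC_m1; ring).
    rewrite <- csum_mult_l; apply csum_ext; intros k _.
    unfold order_coef; rewrite <- !csum_mult_l; apply csum_ext; intros l _.
    rewrite RtoC_m1; ring.
Qed.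

(** The recursion is the rule for one further derivative: [Y (S D)] is the
    derivative of the term of order [S D], in which the mixed derivatives have
    been eliminated. *)
Lemma order_coef_derivative (m : nat) (X Y : nat -> C) :
  Y 0%nat = Cmult (RtoC (1 + (-1) ^ m)) (X 1%nat) ->
  (forall D, (D < m)%nat -> Y (S D) =
     Cminus (X (S (S D)))
       (csum (seq 0 (S D)) (fun k =>
          Cmult (RtoC (Binomial.C D k)) (Cmult (Q k) (X (D - k)%nat))))) ->
  csum (seq 0 (S m)) (fun D => Cmult (order_coef m D) (Y D)) =
  csum (seq 0 (S (S m))) (fun d => Cmult (order_coef (S m) d) (X d)).
Proof.
intros HY0 HY.
set (g := fun d k => Cmult (RtoC (Binomial.C (d + k) k))
                       (Cmult (Q k) (Cmult (order_coef m (d + k + 1)) (X d)))).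
transitivity (Cminus
  (csum (seq 0 (S m)) (fun d =>
     Cmult (Cmult (RtoC (epsilon m (S d))) (order_coef m d)) (X (S d))))
  (csum (seq 0 m) (fun D => csum (seq 0 (S D)) (fun k => g (D - k)%nat k)))).
- rewrite 2!csum_seq_first, HY0.
  rewrite (csum_ext (seq 0 m) _ (fun D => Cplus
    (Cmult (Cmult (RtoC (epsilon m (S (S D)))) (order_coef m (S D))) (X (S (S D))))
    (Cmult (RtoC (-1)) (csum (seq 0 (S D)) (fun k => g (D - k)%nat k))))).
  + rewrite csum_plus, csum_mult_l, RtoC_m1; unfold epsilon; simpl Nat.eqb; cbv iota.
    ring.
  + intros D HD; apply in_seq in HD; rewrite HY by lia.
    rewrite (csum_ext _ (fun k => g (D - k)%nat k) (fun k =>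
      Cmult (order_coef m (S D))
        (Cmult (RtoC (Binomial.C D k)) (Cmult (Q k) (X (D - k)%nat))))).
    * rewrite csum_mult_l, RtoC_m1; unfold epsilon; simpl Nat.eqb; cbv iota; ring.
    * intros k Hk; apply in_seq in Hk; unfold g.
      replace (D - k + k)%nat with D by lia.
      replace (D + 1)%nat with (S D) by lia; ring.
- rewrite csum_triangle.
  rewrite (csum_ext (seq 0 (S (S m))) _ (fun d => Cplus
    (Cmult (match d with
            | O => RtoC 0
            | S d' => Cmult (RtoC (epsilon m d)) (order_coef m d')
            end) (X d))
    (Cmult (RtoC (-1)) (csum (seq 0 (S m)) (g d))))).
  + rewrite csum_plus, csum_mult_l, csum_switch.
    rewrite (csum_seq_first (S m) (fun d => Cmult _ (X d))).
    assert (E : csum (seq 0 (S m)) (fun k => csum (seq 0 (S (S m))) (fun d => g d k)) =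
                csum (seq 0 m) (fun k => csum (seq 0 (m - k)) (fun d => g d k))).
    { rewrite (csum_seq_extend m (S m)); [|lia|].
      - apply csum_ext; intros k _; apply csum_seq_extend; [lia|].
        intros d Hd; unfold g; rewrite order_coef_0 by lia; ring.
      - intros k Hk; apply csum_0; intros d _.
        unfold g; rewrite order_coef_0 by lia; ring. }
    rewrite E, RtoC_m1; ring.
  + intros d _; rewrite order_coef_succ.
    unfold Cminus; rewrite Cmult_plus_distr_r; f_equal.
    transitivity (Cmult (RtoC (-1)) (Cmult (X d) (csum (seq 0 (S m)) (fun k =>
      Cmult (RtoC (Binomial.C (d + k) k)) (Cmult (Q k) (order_coef m (d + k + 1)))))));
      [rewrite RtoC_m1; ring|].
    f_equal; rewrite <- csum_mult_l; apply csum_ext; intros k _; unfold g; ring.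
Qed.

End Coefficients.

(** * Derivatives of the kernel along the antidiagonal *)

Lemma is_derive_on_ext (A : R -> Prop) (F G : R -> C) (x : R) (l : C) :
  A x -> (forall y, A y -> F y = G y) -> is_derive_on A F x l -> is_derive_on A G x l.
Proof.
intros HA HE HF; pose proof (within_locally_proper A x HA) as PF.
apply (filterdiff_ext_loc (V := C_R_NormedModule) F); [| |exact HF].
- unfold within; now apply filter_forall.
- intros y Hy; replace y with x; [now apply HE|].
  apply (is_filter_lim_unique (V := R_NormedModule) (F := within A (locally x)));
    trivial.
  intros P HP; unfold within; revert HP; apply filter_imp; now intros z Hz _.
Qed.

Lemma sign_sqr (m : nat) : (-1) ^ m * (-1) ^ m = 1.
Proof. rewrite <- Rpow_mult_distr; replace (-1 * -1) with 1 by ring; apply pow1. Qed.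

Section Antidiagonal.
Variables (b : R) (N : nat) (q : nat -> R -> C) (h : C) (H : R -> R -> C).
Hypothesis b_pos : 0 < b.
Hypothesis q_cont : forall k x, (k <= N)%nat -> Rabs x < b -> ccont (q k) x.
Hypothesis q_der :
  forall k x, (k < N)%nat -> Rabs x < b -> cderiv (q k) x (q (S k) x).
Hypothesis sol : goursat_solution b (q 0%nat) h H.

Let q0_cont (x : R) : Rabs x < b -> ccont (q 0%nat) x.
Proof. apply q_cont; lia. Qed.

Let Hswap (u v : R) : C := H v u.

Let phi (k : nat) (x : R) : C := Cmult (RtoC (/ 2)) (q k x).

Let phi_der k x : (k < N)%nat -> Rabs x < b -> cderiv (phi k) x (phi (S k) x).
Proof. intros Hk Hx; now apply cderiv_mult_l, q_der. Qed.

Let phi_cont k x : (k <= N)%nat -> Rabs x < b -> ccont (phi k) x.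
Proof.
intros Hk Hx; destruct (q_cont k x Hk Hx) as [H1 H2]; unfold phi; split; simpl.
- apply continuity_pt_minus; apply continuity_pt_mult; trivial;
    apply continuity_pt_const; now intros ? ?.
- apply continuity_pt_plus; apply continuity_pt_mult; trivial;
    apply continuity_pt_const; now intros ? ?.
Qed.

Let zero_der (k : nat) x : (k < N)%nat -> Rabs x < b ->
  cderiv (fun _ => RtoC 0) x (RtoC 0).
Proof. intros _ _; apply cderiv_const. Qed.

Let zero_cont (k : nat) x : (k <= N)%nat -> Rabs x < b -> ccont (fun _ => RtoC 0) x.
Proof. intros _ _; exact (cderiv_ccont _ _ _ (cderiv_const _ x)). Qed.

Let H_cont := H_cont_hexagon b (q 0%nat) h H sol.

Let H_der := H_der_u b (q 0%nat) h H q0_cont sol.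

Let Hswap_cont (u v : R) : hexagon b u v -> ccont2 Hswap u v.
Proof. intros Huv; now apply ccont2_swap, H_cont, hexagon_sym. Qed.

Let Hswap_der (u v : R) : hexagon b u v ->
  cderiv (fun z => Hswap z v) u
    (Cplus (RtoC 0) (cint (fun r => Cmult (q 0%nat (u + r)) (Hswap u r)) 0 v)).
Proof.
intros Huv; rewrite Cplus_0_l; unfold Hswap.
rewrite (cint_ext _ (fun r => Cmult (q 0%nat (r + u)) (H r u)));
  [|intros; now rewrite Rplus_comm].
apply (H_der_v b (q 0%nat) h H q0_cont sol); now apply hexagon_sym.
Qed.

(** The arguments have the form [(c t, -c t)] of [jet_der_antidiagonal], with
    [c = 1/2] here and [c = -1/2] in [line_v]. *)
Definition line_u (d : nat) (t : R) : C := jet H d (/ 2 * t) (- / 2 * t).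
Definition line_v (d : nat) (t : R) : C :=
  jet Hswap d (- / 2 * t) (- - / 2 * t).

Lemma hexagon_antidiagonal (c t : R) :
  Rabs c = / 2 -> Rabs t <= b -> hexagon b (c * t) (- c * t).
Proof.
intros Hc Ht; unfold hexagon.
replace (c * t + - c * t) with 0 by ring.
rewrite !Rabs_mult, Rabs_Ropp, Hc, Rabs_R0; lra.
Qed.

Lemma abs_half : Rabs (/ 2) = / 2.
Proof. apply Rabs_pos_eq; lra. Qed.

Lemma abs_opp_half : Rabs (- / 2) = / 2.
Proof. rewrite Rabs_Ropp; apply abs_half. Qed.

Lemma leib_antidiagonal (F : R -> R -> C) (d : nat) (c t : R) :
  leib q F d (c * t) (- c * t) =
  csum (seq 0 (S d)) (fun k => Cmult (RtoC (Binomial.C d k))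
    (Cmult (q k 0) (jet F (d - k) (c * t) (- c * t)))).
Proof. unfold leib; now replace (c * t + - c * t) with 0 by ring. Qed.

Lemma line_u_der (d : nat) (t : R) :
  (d < N)%nat -> Rabs t <= b ->
  cderiv (line_u (S d)) t (Cmult (RtoC (/ 2)) (Cminus (line_u (S (S d)) t)
    (csum (seq 0 (S d)) (fun k => Cmult (RtoC (Binomial.C d k))
       (Cmult (q k 0) (line_u (d - k) t)))))).
Proof.
intros Hd Ht; unfold line_u; rewrite <- leib_antidiagonal.
apply (jet_der_antidiagonal b N q phi H); trivial.
apply hexagon_antidiagonal; [apply abs_half | exact Ht].
Qed.

Lemma line_v_der (d : nat) (t : R) :
  (d < N)%nat -> Rabs t <= b ->
  cderiv (line_v (S d)) t (Cmult (RtoC (- / 2)) (Cminus (line_v (S (S d)) t)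
    (csum (seq 0 (S d)) (fun k => Cmult (RtoC (Binomial.C d k))
       (Cmult (q k 0) (line_v (d - k) t)))))).
Proof.
intros Hd Ht; unfold line_v; rewrite <- leib_antidiagonal.
apply (jet_der_antidiagonal b N q (fun _ _ => RtoC 0) Hswap); trivial.
apply hexagon_antidiagonal; [apply abs_opp_half | exact Ht].
Qed.

Lemma line_0 (t : R) : line_v 0 t = line_u 0 t.
Proof. unfold line_u, line_v; simpl; unfold Hswap; now rewrite Ropp_involutive. Qed.

Lemma line_u_0_der (t : R) : Rabs t <= b ->
  cderiv (line_u 0) t (Cmult (RtoC (/ 2)) (Cminus (line_u 1 t) (line_v 1 t))).
Proof.
intros Ht.
assert (Hh : hexagon b (/ 2 * t) (- / 2 * t))
  by (apply hexagon_antidiagonal; [apply abs_half | exact Ht]).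
assert (Hv : cderiv (fun z => H (/ 2 * t) z) (- / 2 * t) (line_v 1 t)).
{ apply hexagon_sym in Hh; unfold line_v; rewrite Ropp_involutive.
  apply (jet_der_u b N q (fun _ _ => RtoC 0) Hswap) with (d := 0%nat); trivial; lia. }
eapply cderiv_eq.
- apply (cderiv_along_curve H (jet H 1) (fun s => / 2 * s) (fun s => - / 2 * s)
           t (/ 2) (- / 2) (line_v 1 t)).
  + destruct (hexagon_open b _ _ Hh) as [dl Hdl]; exists dl.
    intros u v Hu Hv'.
    apply (jet_der_u b N q phi H) with (d := 0%nat); trivial; [lia | now apply Hdl].
  + apply (jet_cont b N q phi H); trivial; lia.
  + exact Hv.
  + auto_derive; [trivial | ring].
  + auto_derive; [trivial | ring].
- unfold line_u; rewrite (RtoC_opp (/ 2)); ring.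
Qed.

Lemma line_u_origin (d : nat) : (d <= N)%nat -> line_u (S d) 0 = phi d 0.
Proof.
intros Hd; unfold line_u; rewrite !Rmult_0_r.
now apply (jet_origin b N q phi H).
Qed.

Lemma line_v_origin (d : nat) : (d <= N)%nat -> line_v (S d) 0 = RtoC 0.
Proof.
intros Hd; unfold line_v; rewrite !Rmult_0_r.
now apply (jet_origin b N q (fun _ _ => RtoC 0) Hswap).
Qed.

Let Q (k : nat) : C := q k 0.

Definition line_sum (m : nat) (t : R) : C :=
  Cmult (RtoC (/ 2 ^ m))
    (csum (seq 0 (S m)) (fun d => Cmult (order_coef Q m d)
       (Cplus (line_u d t) (Cmult (RtoC ((-1) ^ m)) (line_v d t))))).

(** One application of half of [d_u - d_v]. The sign [(-1)^m] of the
    [v]-derivatives alternates because that operator is antisymmetric under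
    the exchange of [u] and [v]. *)
Lemma line_sum_der (m : nat) (t : R) :
  (m <= N)%nat -> Rabs t <= b -> cderiv (line_sum m) t (line_sum (S m) t).
Proof.
intros Hm Ht.
set (X := fun d => Cplus (line_u d t) (Cmult (RtoC ((-1) ^ S m)) (line_v d t))).
set (Y := fun d => match d with
  | O => Cmult (RtoC (1 + (-1) ^ m)) (X 1%nat)
  | S D => Cminus (X (S (S D))) (csum (seq 0 (S D)) (fun k =>
             Cmult (RtoC (Binomial.C D k)) (Cmult (Q k) (X (D - k)%nat))))
  end).
assert (Hsgn : RtoC ((-1) ^ S m) = Copp (RtoC ((-1) ^ m)))
  by (change ((-1) ^ S m) with (-1 * (-1) ^ m); rewrite RtoC_mult, RtoC_m1; ring).
eapply cderiv_eq.
- apply cderiv_mult_l, (cderiv_csum (seq 0 (S m))) with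
    (F' := fun d => Cmult (order_coef Q m d) (Cmult (RtoC (/ 2)) (Y d))).
  intros d Hd; apply in_seq in Hd; apply cderiv_mult_l.
  destruct d as [|D].
  + apply cderiv_ext_loc with (fun s => Cmult (RtoC (1 + (-1) ^ m)) (line_u 0 s)).
    { apply filter_forall; intros s; rewrite line_0, RtoC_plus; ring. }
    eapply cderiv_eq; [now apply cderiv_mult_l, line_u_0_der|].
    unfold Y, X; rewrite Hsgn, RtoC_plus.
    assert (Hsq : Cmult (RtoC ((-1) ^ m)) (RtoC ((-1) ^ m)) = RtoC 1)
      by (rewrite <- RtoC_mult, sign_sqr; reflexivity).
    revert Hsq; generalize (RtoC ((-1) ^ m)); intros e He.
    transitivity (Cmult (RtoC (/ 2)) (Cplus (Cmult (Cplus (RtoC 1) e) (line_u 1 t))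
      (Cmult (Copp (Cplus e (Cmult e e))) (line_v 1 t)))); [rewrite He|]; ring.
  + eapply cderiv_eq.
    * apply cderiv_plus; [apply line_u_der; trivial; lia|].
      apply cderiv_mult_l, line_v_der; trivial; lia.
    * unfold Y, X; rewrite Hsgn.
      rewrite (csum_ext _ (fun k => Cmult (RtoC (Binomial.C D k)) (Cmult (Q k)
          (Cplus (line_u (D - k) t)
                 (Cmult (Copp (RtoC ((-1) ^ m))) (line_v (D - k) t)))))
        (fun k => Cplus
          (Cmult (RtoC (Binomial.C D k)) (Cmult (q k 0) (line_u (D - k) t)))
          (Cmult (Copp (RtoC ((-1) ^ m)))
            (Cmult (RtoC (Binomial.C D k)) (Cmult (q k 0) (line_v (D - k) t))))))
        by (intros; unfold Q; ring).
      rewrite csum_plus, csum_mult_l, RtoC_opp; ring.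
- change (line_sum (S m) t) with (Cmult (RtoC (/ 2 ^ S m))
    (csum (seq 0 (S (S m))) (fun d => Cmult (order_coef Q (S m) d) (X d)))).
  rewrite <- (order_coef_derivative Q m X Y) by reflexivity.
  rewrite (csum_ext _ _ (fun d => Cmult (RtoC (/ 2)) (Cmult (order_coef Q m d) (Y d))))
    by (intros; ring).
  rewrite csum_mult_l, Cmult_assoc, <- RtoC_mult; f_equal; f_equal.
  simpl; field; apply pow_nonzero; lra.
Qed.

Lemma line_sum_0 (t : R) : line_sum 0 t = kernel H 0 t.
Proof.
transitivity (H (/ 2 * t) (- / 2 * t)).
- unfold line_sum, csum; simpl.
  rewrite line_0; unfold order_coef, list_coef, csum; simpl.
  replace (/ 1) with 1 by field.
  unfold line_u; simpl.
  transitivity (Cmult (RtoC (/ 2 + / 2)) (H (/ 2 * t) (- / 2 * t)));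
    [rewrite RtoC_plus; ring|].
  replace (/ 2 + / 2) with 1 by field; ring.
- unfold kernel; f_equal; field.
Qed.

(** The points of the antidiagonal with [|t| <= b] are interior to the hexagon,
    end points included, so the one-sided derivatives at [t = b] and [t = -b]
    are restrictions of two-sided ones. *)
Lemma kernel_derivatives (n : nat) :
  (n <= S N)%nat ->
  ex_derive_n_on (Icc (- b) b) (kernel H 0) n /\
  forall t, Icc (- b) b t -> derive_n_on (Icc (- b) b) (kernel H 0) n t = line_sum n t.
Proof.
assert (Abs : forall t, Icc (- b) b t -> Rabs t <= b)
  by (intros t Ht; now apply Rabs_le_between).
induction n as [|n IH]; intros Hn.
- split; [intros j Hj; lia | intros t _; now rewrite line_sum_0].
- destruct IH as [IHe IHd]; [lia|].
  assert (Hd : forall t, Icc (- b) b t ->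
    is_derive_on (Icc (- b) b) (derive_n_on (Icc (- b) b) (kernel H 0) n) t
      (line_sum (S n) t)).
  { intros t Ht; apply is_derive_on_ext with (line_sum n); trivial.
    - intros y Hy; symmetry; now apply IHd.
    - apply cderiv_is_derive_on; trivial; apply line_sum_der; [lia | now apply Abs]. }
  split.
  + intros j Hj t Ht; destruct (Nat.eq_dec j n) as [-> | Hjn].
    * exists (line_sum (S n) t); now apply Hd.
    * apply IHe; trivial; lia.
  + intros t Ht; apply (derive_on_correct (- b) b); trivial; [lra | now apply Hd].
Qed.

Lemma line_sum_origin (n : nat) :
  (n <= S N)%nat ->
  line_sum n 0 = Cmult (RtoC (/ 2 ^ (n + 1))) (csum (seq 0 (S n)) (fun d =>
    Cmult (Cmult (RtoC (1 + (-1) ^ n * delta d))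
                 (match d with O => h | S k => q k 0 end))
          (order_coef Q n d))).
Proof.
intros Hn; unfold line_sum.
replace (/ 2 ^ (n + 1)) with (/ 2 ^ n * / 2)
  by (rewrite pow_add, pow_1, Rinv_mult; reflexivity).
rewrite RtoC_mult, <- Cmult_assoc; f_equal; rewrite <- csum_mult_l; apply csum_ext.
intros d Hd; apply in_seq in Hd; destruct d as [|k].
- rewrite line_0; unfold line_u; simpl jet; rewrite !Rmult_0_r.
  rewrite (goursat_boundary_v _ _ _ _ sol) by (rewrite Rabs_R0; lra).
  unfold delta; simpl Nat.eqb; cbv iota.
  rewrite Rmult_1_r, RtoC_plus, RtoC_inv by lra; unfold Cdiv; ring.
- rewrite line_u_origin, line_v_origin by lia.
  unfold delta, phi; simpl Nat.eqb; cbv iota.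
  rewrite Rmult_0_r, Rplus_0_r; ring.
Qed.

End Antidiagonal.

(** * The closed formula *)

Lemma sum_n_m_0_csum (F : nat -> C) (m : nat) :
  sum_n_m (G := C_AbelianMonoid) F 0 m = csum (seq 0 (S m)) F.
Proof.
induction m as [|m IH].
- rewrite sum_n_n; unfold csum; simpl; symmetry; apply Cplus_0_r.
- rewrite sum_n_Sm, IH, (csum_seq_last (S m)) by lia; reflexivity.
Qed.

Lemma sum_n_m_1_csum (F : nat -> C) (m : nat) :
  sum_n_m (G := C_AbelianMonoid) F 1 m = csum (seq 0 m) (fun l => F (S l)).
Proof.
destruct m as [|m]; [now rewrite sum_n_m_zero by lia|].
now rewrite <- sum_n_m_S, sum_n_m_0_csum.
Qed.

(** The lists of length 0 contribute one single term, that of order [n]. *)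
Lemma order_coef_sum (Q : nat -> C) (n : nat) (T : nat -> C) :
  csum (seq 0 (S n)) (fun d => Cmult (T d) (order_coef Q n d)) =
  Cplus (Cmult (RtoC (Scoef n 0 n nil)) (T n))
    (csum (seq 0 (n / 2)) (fun l => Cmult (RtoC ((-1) ^ S l))
      (csum (seq 0 (S (n - 2 * S l))) (fun d => Cmult (T d) (list_coef Q n (S l) d))))).
Proof.
transitivity (csum (seq 0 (S n)) (fun l => Cmult (RtoC ((-1) ^ l))
  (csum (seq 0 (S n)) (fun d => Cmult (T d) (list_coef Q n l d))))).
{ rewrite (csum_ext _ _ (fun d => csum (seq 0 (S n)) (fun l =>
    Cmult (RtoC ((-1) ^ l)) (Cmult (T d) (list_coef Q n l d))))).
  - rewrite csum_switch; apply csum_ext; intros l _; apply csum_mult_l.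
  - intros d _; unfold order_coef; rewrite <- csum_mult_l.
    apply csum_ext; intros l _; ring. }
rewrite csum_seq_first; f_equal.
- rewrite csum_seq_last, csum_0.
  + unfold list_coef; rewrite Nat.sub_diag; unfold csum; simpl; ring.
  + intros d Hd; apply in_seq in Hd; unfold list_coef; rewrite csum_0; [ring|].
    intros ns Hns; apply in_sum_lists in Hns; destruct Hns as [Hl [_ Hs]].
    destruct ns; simpl in *; lia.
- rewrite (csum_seq_extend (n / 2) n).
  + apply csum_ext; intros l _; f_equal; apply csum_seq_extend; [lia|].
    intros d Hd; rewrite list_coef_0 by lia; ring.
  + apply Nat.Div0.div_le_upper_bound; lia.
  + intros l Hl; rewrite csum_0; [ring|].
    intros d _; rewrite list_coef_0; [ring|].
    pose proof (Nat.div_mod_eq n 2); pose proof (Nat.mod_upper_bound n 2); lia.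
Qed.

(* For [n = 0] the truncated [n - 1] makes the regularity hypothesis plain
   continuity of the potential, as in the last sentence of the result. *)
Theorem proposition8p6 (b : R) (f : R -> C) (H : R -> R -> C) (n : nat) :
  0 < b ->
  Ck_on (Icc (- b) b) 2 f ->
  (forall x : R, Icc (- b) b x -> f x <> RtoC 0) ->
  f 0 = RtoC 1 ->
  goursat_solution b (potential b f) (slope0 b f) H ->
  Ck_on (Icc (- b) b) (n - 1) (potential b f) ->
  is_derive_n_on (Icc (- b) b) (fun t : R => kernel H 0 t) n 0
    (Cmult (RtoC (/ 2 ^ (n + 1)))
       (Cplus (qjet b f n)
          (sum_n_m (G := C_AbelianMonoid)
             (fun l : nat =>
                Cmult (RtoC ((-1) ^ l))
                  (sum_n_m (G := C_AbelianMonoid)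
                     (fun d : nat =>
                        Cmult
                          (Cmult (RtoC (1 + (-1) ^ n * delta d)) (qjet b f d))
                          (Clist_sum
                             (map
                                (fun ns : list nat =>
                                   Cmult (RtoC (Scoef n l d ns))
                                     (Clist_prod
                                        (map (fun k : nat => qjet b f (k + 1))
                                             ns)))
                                (sum_lists l (n - d - 2 * l)))))
                     0 (n - 2 * l)))
             1 (Nat.div n 2)))).
Proof.
intros Hb _ _ _ Hsol HC.
set (q := derive_n_on (Icc (- b) b) (potential b f)).
assert (q_cont : forall k x, (k <= n - 1)%nat -> Rabs x < b -> ccont (q k) x)
  by (intros k x Hk Hx; now apply Ck_on_ccont with (n - 1)%nat).
assert (q_der : forall k x, (k < n - 1)%nat -> Rabs x < b ->
                cderiv (q k) x (q (S k) x))
  by (intros k x Hk Hx; now apply Ck_on_cderiv with (n - 1)%nat).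
assert (Hn : (n <= S (n - 1))%nat) by lia.
destruct (kernel_derivatives b (n - 1) q (slope0 b f) H Hb q_cont q_der Hsol n Hn)
  as [Hex Hval].
split; [exact Hex|].
rewrite Hval by (unfold Icc; lra).
rewrite (line_sum_origin b (n - 1) q (slope0 b f) H Hb q_cont q_der Hsol n Hn).
f_equal; rewrite order_coef_sum; f_equal.
- destruct n as [|n].
  + simpl; unfold delta; simpl; rewrite Rmult_1_r, Cmult_assoc, <- RtoC_mult.
    replace (/ 2 * (1 + 1)) with 1 by field; apply Cmult_1_l.
  + rewrite Scoef_l0 by lia; unfold delta; simpl Nat.eqb; cbv iota.
    rewrite Rmult_0_r, Rplus_0_r, !Cmult_1_l; reflexivity.
- rewrite sum_n_m_1_csum; apply csum_ext; intros l _; f_equal.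
  rewrite sum_n_m_0_csum; apply csum_ext; intros d _; f_equal.
  apply csum_ext; intros ns _; f_equal; f_equal; apply map_ext.
  intros k; now rewrite Nat.add_1_r.
Qed.
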